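(* Let $\xi_1,\xi_2,\ldots$ be a positive recurrent Markov chain with transition kernel $p$, invariant probability measure $\pi$ and Markov operator $P$. Then the following two statements are equivalent: (1) $P$ has an $L^2(\pi)$-spectral gap. (2) There exists $n_0\in\mathbb{N}$ such that $k_{P^{*n_0}P^{n_0}}>0$. Moreover, if $n_0\in\mathbb{N}$ is such that $k_{P^{*n_0}P^{n_0}}>0$, then the spectrum $\sigma(P)$ of $P$ acting on $L^2_0(\pi)$ satisfies $$\sigma(P)\subset\{z\in\mathbb{C}:|z|\le r\},\qquad r=\left(\sqrt{1-\frac{\kappa}{8}\,k_{P^{*n_0}P^{n_0}}^{2}}\right)^{1/n_0}.$$
   Context: Setting: $\xi_1,\xi_2,\ldots$ is a time-homogeneous, discrete-time, positive recurrent Markov chain on an arbitrary measurable state space $(\Omega,\mathcal{F})$ with transition kernel $p(x,dy)$ and uniquely determined invariant probability measure $\pi$. The Markov operator is $Pf(x)=\int_\Omega f(y)\,p(x,dy)$ on $L^2(\pi)$, and $P^*$ is its adjoint on $L^2(\pi)$. $P^{*n}$ means $(P^* )^n$. Let $L^2_0(\pi)=\{f\in L^2(\pi):\int f\,d\pi=0\}$ (invariant under $P$) and $L^2_{0,1}(\pi)=\{f\in L^2_0(\pi):\int f^2\,d\pi=1\}$. $P$ has an $L^2(\pi)$-spectral gap if $\lim_{n\to\infty}\sup_{f\in L^2_{0,1}(\pi)}\|P^nf\|_2^{1/n}<1$. Spectra are taken over the complex scalars. Isoperimetric constants: for $n\in\mathbb{N}$, $$k_{P^{*n}P^n}:=\inf_{A}\frac{1}{\pi(A)\pi(A^c)}\int_A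 P^{*n}P^n1_{A^c}(x)\,\pi(dx),$$ the infimum being over $A\in\mathcal{F}$ with $0<\pi(A)<1$. The constant $\kappa$ is the constant of Lawler and Sokal: $\kappa=\inf\sup_{c\in\mathbb{R}}\frac{\left(\mathbb{E}|(X+c)^2-(Y+c)^2|\right)^2}{\mathbb{E}[(X+c)^2]}$, the infimum being over all distributions of pairs of i.i.d. real random variables $X,Y$ with variance $1$. *)

(* Defs.v *)
From HB Require Import structures.
From mathcomp Require Import all_boot all_order all_algebra.
From mathcomp Require Import all_classical all_reals all_analysis.
From mathcomp Require Import complex.

Set Implicit Arguments.
Unset Strict Implicit.
Unset Printing Implicit Defensive.

Import Order.TTheory GRing.Theory Num.Theory.
Import numFieldNormedType.Exports.

Local Open Scope classical_set_scope.
Local Open Scope ring_scope.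

(* Elements of L^2 are represented by functions, as in the
   library's [Lfun]; identities between elements of L^2 are stated almost
   everywhere. *)

Section chain.
Context (R : realType) (d : measure_display) (Omega : measurableType d).
Variable p : R.-pker Omega ~> Omega.

Definition invariant_measure (mu : probability Omega R) : Prop :=
  forall A, measurable A -> (\int[mu]_x p x A = mu A)%E.

Definition kernel_iter (n : nat) (x : Omega) (A : set Omega) : \bar R :=
  iter n (fun u y => \int[p y]_z u z)%E (fun y => \d_y A) x.

(* Recurrence on a general state space in the sense of Meyn and Tweedie.  The
   usual irreducibility requirement (every set of positive phi-measure is
   reached with positive probability from every point) is the positivity of the
   same series, hence it is implied. *)
Definition recurrent : Prop :=
  exists2 phi : {sigma_finite_measure set Omega -> \bar R},
    (0 < phi setT)%E &
    forall A, measurable A -> (0 < phi A)%E ->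
      forall x, (\sum_(1 <= n <oo) kernel_iter n x A = +oo)%E.

Definition positive_recurrent : Prop :=
  recurrent /\ exists mu : probability Omega R, invariant_measure mu.

Definition unique_invariant_measure (mu : probability Omega R) : Prop :=
  invariant_measure mu /\
  forall nu : probability Omega R, invariant_measure nu ->
    forall A, measurable A -> nu A = mu A.

(* For f in L^2(pi), f is p(x, dy)-integrable for pi-almost every x; on the
   exceptional null set [Rintegral] returns an arbitrary real value. *)
Definition markov_op (f : Omega -> R) : Omega -> R :=
  fun x => \int[p x]_y f y.

End chain.

Section L2.
Context (R : realType) (d : measure_display) (Omega : measurableType d).
Variable pi : probability Omega R.

(* The Hilbert-space adjoint of an operator S on L^2(pi).  The value at a given
   g is determined up to a pi-null set; [xget] picks one version. *)
Definition adjoint (S : (Omega -> R) -> Omega -> R) (g : Omega -> R) :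
    Omega -> R :=
  xget (cst 0) [set h | h \in Lfun pi 2%:E /\
    forall f, f \in Lfun pi 2%:E ->
      \int[pi]_x (S f x * g x) = \int[pi]_x (f x * h x)].

Definition L20 : set (Omega -> R) :=
  [set f | f \in Lfun pi 2%:E /\ \int[pi]_x f x = 0].

Definition L201 : set (Omega -> R) :=
  [set f | L20 f /\ \int[pi]_x (f x ^+ 2) = 1].

(* If L^2_0(pi) is trivial, the suprema are taken over the empty set and are
   equal to -oo, so that the property holds. *)
Definition spectral_gap (S : (Omega -> R) -> Omega -> R) : Prop :=
  exists2 l : \bar R, (l < 1)%E &
    (fun n : nat =>
      ereal_sup [set ('N[pi]_2%:E[EFin \o iter n S f] `^ (n%:R^-1))%E
                | f in L201]) @ \oo --> l.

(* The value is +oo if there is no A with 0 < pi(A) < 1; the space L^2_0(pi) is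
   then trivial, and any operator on it has empty spectrum. *)
Definition isoperimetric_constant (S : (Omega -> R) -> Omega -> R) : \bar R :=
  ereal_inf [set ((\int[pi]_(x in A) (S \1_(~` A) x)%:E)
                  / (pi A * pi (~` A)))%E
            | A in [set A | measurable A /\ (0 < pi A < 1)%E]].

End L2.

Section complex_L2.
Context (R : realType) (d : measure_display) (Omega : measurableType d).

Definition cintegral (mu : {measure set Omega -> \bar R}) (f : Omega -> R[i]) :
    R[i] :=
  Complex (\int[mu]_x complex.Re (f x)) (\int[mu]_x complex.Im (f x)).

Definition cmarkov_op (p : R.-pker Omega ~> Omega) (f : Omega -> R[i]) :
    Omega -> R[i] :=
  fun x => cintegral (p x) f.

Variable pi : probability Omega R.

Definition cL20 : set (Omega -> R[i]) :=
  [set f | [/\ (fun x => complex.Re (f x)) \in Lfun pi 2%:E,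
               (fun x => complex.Im (f x)) \in Lfun pi 2%:E &
               cintegral pi f = 0]].

Definition cL2norm (f : Omega -> R[i]) : \bar R :=
  'N[pi]_2%:E[(fun x => (complex.Re `|f x|)%:E)].

(* z belongs to the resolvent set if z - S has a bounded inverse on the complex
   space L^2_0(pi).  Being an inverse of a linear operator, T is automatically
   linear and compatible with almost everywhere equality. *)
Definition resolvent_set (S : (Omega -> R[i]) -> Omega -> R[i]) : set R[i] :=
  [set z | exists T : (Omega -> R[i]) -> Omega -> R[i],
    [/\ forall f, cL20 f -> cL20 (T f),
        exists C : R, forall f, cL20 f ->
          (cL2norm (T f) <= C%:E * cL2norm f)%E,
        forall f, cL20 f ->
          {ae pi, forall x, T (fun y => z * f y - S f y) x = f x} &
        forall f, cL20 f ->
          {ae pi, forall x, z * T f x - S (T f) x = f x}]].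

Definition spectrum (S : (Omega -> R[i]) -> Omega -> R[i]) : set R[i] :=
  ~` resolvent_set S.

End complex_L2.

(* The distribution of an i.i.d. pair (X, Y) is a product mu \x mu, so the
   infimum ranges over the probability measures mu on the line with variance 1,
   and X and Y are the two coordinates. *)
Definition lawler_sokal (R : realType) : R :=
  fine (ereal_inf
    [set ereal_sup
       [set ((\int[(mu \x mu)%E]_w
                (`|(w.1 + c) ^+ 2 - (w.2 + c) ^+ 2|)%:E) ^+ 2
             / 'E_mu[(fun x : R => (x + c) ^+ 2)%R])%E | c in [set: R]]
    | mu in [set mu : probability (measurableTypeR R) R |
              (idfun : R -> R) \in Lfun mu 2%:E /\
              ('V_mu[(idfun : R -> R)] = 1)%E]]).

Section constants.
Context (R : realType) (d : measure_display) (Omega : measurableType d).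
Variables (p : R.-pker Omega ~> Omega) (pi : probability Omega R).

Definition kPP (n : nat) : \bar R :=
  isoperimetric_constant pi (fun f =>
    iter n (adjoint pi (markov_op p)) (iter n (markov_op p) f)).

End constants.

(* Main.v *)
Require Import Defs.
From HB Require Import structures.
From mathcomp Require Import all_boot all_order all_algebra.
From mathcomp Require Import all_classical all_reals all_analysis.
From mathcomp Require Import complex.
From mathcomp Require Import measurable_realfun ring lra.

Set Implicit Arguments.
Unset Strict Implicit.
Unset Printing Implicit Defensive.

Import Order.TTheory GRing.Theory Num.Theory.
Import numFieldNormedType.Exports.

Local Open Scope classical_set_scope.
Local Open Scope ring_scope.

(* For a probability kernel q with invariant measure pi and f in L^2_0(pi),
   |f|^2 - |q f|^2 is the pi-average over x of the variance of f under q(x, .).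
   Writing g = f + c, an AM-GM estimate under q(x, .) x q(x, .), averaged over
   pi, bounds the mean of |g(y)^2 - g(y')^2| over pairs of independent q-steps
   from a common starting point by this variance and |g|^2.  The layer-cake
   formula and the isoperimetric constant k of q^* q bound the same mean from
   below by k times the mean of |g(x)^2 - g(y)^2| under pi x pi, and the choice
   of c yields |q f|^2 <= (1 - kappa k^2 / 8) |f|^2.  This is applied to
   q = p^n.  Adjoints of bounded functions are Radon-Nikodym densities, so that
   <1_A, P^*n P^n 1_{A^c}> is an integral of p^n(x, A) p^n(x, A^c).
   Conversely, a contraction of P^n on L^2_0 applied to 1_A - pi(A) bounds k
   from below.  The limit in the spectral gap exists by submultiplicativity, and
   outside the disc of radius r the Neumann series for (z - P)^-1 converges
   almost everywhere and in L^2. *)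

(** * Square-integrable functions and Markov operators *)

(** Elements of L^2 are functions here, not classes, and [Rintegral] takes a default value where the
    integrand is not integrable. Hence P^n f and the operator of p^n agree only almost everywhere,
    and a series in P^j f needs a pointwise criterion of convergence. That criterion is a finite
    [energy], which holds pi-almost everywhere; by invariance the energy is also p(x, .)-integrable
    for almost every x, so that P may be applied term by term. The AM-GM parameter lam stays free
    until all integrations are done, so that only linear inequalities are integrated; the choice of
    lam at the end produces the 8 of kappa / 8. The equivalence calls for a factor strictly below 1.
    It is obtained with the explicit constant 1/64 in place of kappa / 8, by testing only the shifts
    c = 0 and c = 1. *)

Section square_integrable.
Context (R : realType) (d : measure_display) (T : measurableType d).
Variable m : probability T R.
Implicit Types f g : T -> R.

Lemma Lfun2P f : f \in Lfun m 2%:E <->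
  measurable_fun [set: T] f /\ (\int[m]_x (f x ^+ 2)%:E < +oo)%E.
Proof.
split.
  move=> fL; split; first by move: fL; rewrite inE => /andP[]; rewrite inE.
  have /integrableP[_] := Lfun2_integrable_sqr fL.
  by under eq_integral do rewrite gee0_abs ?lee_fin ?sqr_ge0//.
move=> [mf f2]; rewrite inE; apply/andP; split; rewrite inE//=.
rewrite /finite_norm unlock poweR_lty//.
by under eq_integral do rewrite /= powR_mulrn ?normr_ge0 // -normrX
  ger0_norm ?sqr_ge0//.
Qed.

Lemma Lnorm2E f : ('N[m]_2%:E[EFin \o f] = (\int[m]_x (f x ^+ 2)%:E) `^ 2^-1)%E.
Proof.
rewrite unlock; under eq_integral do rewrite /= powR_mulrn ?normr_ge0 // -normrX
  ger0_norm ?sqr_ge0//.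
by [].
Qed.

Lemma Lfun2_measurable f : f \in Lfun m 2%:E -> measurable_fun [set: T] f.
Proof. by case/Lfun2P. Qed.

Lemma Lfun2_integral_sqr f : f \in Lfun m 2%:E ->
  (\int[m]_x (f x ^+ 2)%:E)%E = (\int[m]_x (f x ^+ 2))%:E.
Proof.
case/Lfun2P => mf f2; rewrite fineK// ge0_fin_numE// integral_ge0// => x _.
by rewrite lee_fin sqr_ge0.
Qed.

Lemma Lfun2_le f g : measurable_fun [set: T] f -> g \in Lfun m 2%:E ->
  {ae m, forall x, `|f x| <= `|g x|} -> f \in Lfun m 2%:E.
Proof.
move=> mf /Lfun2P[mg g2] fg; apply/Lfun2P; split => //.
apply: le_lt_trans g2; apply: ae_ge0_le_integral => //.
- by move=> x _; rewrite lee_fin sqr_ge0.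
- exact/measurable_EFinP/measurable_funX.
- by move=> x _; rewrite lee_fin sqr_ge0.
- exact/measurable_EFinP/measurable_funX.
apply: filterS fg => x fg _; rewrite lee_fin -(real_normK (num_real (f x))) -(real_normK (num_real (g x))).
by rewrite lerXn2r ?nnegrE.
Qed.

Lemma Lfun2Z a f : f \in Lfun m 2%:E -> (fun x => a * f x) \in Lfun m 2%:E.
Proof.
move=> fL; rewrite (_ : (fun x => a * f x) = a \o* f).
  by apply: Lfun_scale; rewrite ?ler1n.
by apply/funext => x /=; rewrite mulrC.
Qed.

Lemma Lfun2D f g : f \in Lfun m 2%:E -> g \in Lfun m 2%:E ->
  (fun x => f x + g x) \in Lfun m 2%:E.
Proof.
move=> /andP[/[!inE] /= mf f2] /andP[/[!inE] /= mg g2].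
apply/andP; split; rewrite inE/=; first exact: measurable_funD.
rewrite /finite_norm (le_lt_trans (@minkowski_EFin _ _ _ m f g 2 mf mg _)) ?ler1n//.
by rewrite lte_add_pinfty.
Qed.

Lemma Lfun2B f g : f \in Lfun m 2%:E -> g \in Lfun m 2%:E ->
  (fun x => f x - g x) \in Lfun m 2%:E.
Proof.
move=> fL /(Lfun2Z (-1)) gL; rewrite (_ : (fun x => f x - g x) = fun x => f x + -1 * g x).
  exact: Lfun2D.
by apply/funext => x; rewrite mulN1r.
Qed.

Lemma Lfun2_cst c : (fun=> c) \in Lfun m 2%:E.
Proof. exact: Lfun_cst. Qed.

Lemma Lfun2_integrable f : f \in Lfun m 2%:E -> m.-integrable [set: T] (EFin \o f).
Proof.
move=> fL; apply/Lfun1_integrable; apply: (Lfun_subset12 _ fL).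
exact: fin_num_measure.
Qed.

Lemma Lfun2_integrableM f g : f \in Lfun m 2%:E -> g \in Lfun m 2%:E ->
  m.-integrable [set: T] (EFin \o (fun x => f x * g x)).
Proof. by move=> fL gL; apply/Lfun1_integrable/Lfun2_mul_Lfun1. Qed.

Lemma Lfun2_bounded M f : measurable_fun [set: T] f ->
  {ae m, forall x, `|f x| <= M} -> f \in Lfun m 2%:E.
Proof.
move=> mf fM; apply: (@Lfun2_le _ (fun=> M)) => //; first exact: Lfun2_cst.
by apply: filterS fM => x fM; rewrite (le_trans fM)// ler_norm.
Qed.

Lemma Lfun2_indic A : measurable A -> (\1_A : T -> R) \in Lfun m 2%:E.
Proof.
move=> mA; apply: (@Lfun2_bounded 1) => //.
by apply: aeW => x; rewrite indicE; case: (_ \in _); rewrite ?normr1// normr0.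
Qed.

Lemma ae_eq_Rintegral (f g : T -> R) :
  measurable_fun [set: T] f -> measurable_fun [set: T] g ->
  {ae m, forall x, f x = g x} -> \int[m]_x f x = \int[m]_x g x.
Proof.
move=> mf mg fg; congr fine; apply: ae_eq_integral => //.
- exact/measurable_EFinP.
- exact/measurable_EFinP.
by apply: filterS fg => x fg _; rewrite fg.
Qed.

Lemma Rintegral_cst1 c : \int[m]_x c = c.
Proof. by rewrite Rintegral_cst//= probability_setT mulr1. Qed.

Lemma Rintegral_sqrDc f c : f \in Lfun m 2%:E ->
  \int[m]_x ((f x + c) ^+ 2) =
  \int[m]_x (f x ^+ 2) + 2 * c * \int[m]_x f x + c ^+ 2.
Proof.
move=> fL.
transitivity (\int[m]_x (f x ^+ 2 + ((2 * c) * f x + c ^+ 2))).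
  by apply: eq_Rintegral => x _; ring.
have i1 := Lfun2_integrable_sqr fL; have i2 := Lfun2_integrable (Lfun2Z (2 * c) fL).
have i3 := Lfun2_integrable (Lfun2_cst (c ^+ 2)).
rewrite RintegralD//; last exact: (Lfun2_integrable (Lfun2D (Lfun2Z (2 * c) fL) (Lfun2_cst (c ^+ 2)))).
by rewrite RintegralD// RintegralZl//; [rewrite Rintegral_cst1 addrA|exact: Lfun2_integrable].
Qed.

Lemma Rintegral_sqrZ f c : f \in Lfun m 2%:E ->
  \int[m]_x ((c * f x) ^+ 2) = c ^+ 2 * \int[m]_x (f x ^+ 2).
Proof.
move=> fL; rewrite -RintegralZl//; last exact: Lfun2_integrable_sqr.
by apply: eq_Rintegral => x _; rewrite exprMn.
Qed.

(** Jensen for the square, read off from the nonnegativity of the variance. *)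
Lemma sqr_Rintegral_le f : f \in Lfun m 2%:E ->
  (\int[m]_x f x) ^+ 2 <= \int[m]_x (f x ^+ 2).
Proof.
move=> fL; have := Rintegral_sqrDc (- \int[m]_x f x) fL.
have : 0 <= \int[m]_x ((f x + - \int[m]_x f x) ^+ 2).
  by apply: Rintegral_ge0 => x _; exact: sqr_ge0.
by move=> + E; rewrite E; lra.
Qed.

End square_integrable.

Section kernel_prob.
Context (R : realType) (d d' : measure_display).
Context (X : measurableType d) (Y : measurableType d').
Variables (q : R.-pker X ~> Y) (x : X).

(** [q x] is typed as a mere measure; this copy carries the structure of a probability, so that the
    L^2 lemmas above apply to q(x, .). *)
Definition kernel_prob : set Y -> \bar R := q x.

HB.instance Definition _ := Measure.on kernel_prob.

HB.instance Definition _ :=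
  Measure_isProbability.Build _ _ _ kernel_prob (@prob_kernel _ _ _ _ _ q x).

Lemma kernel_probE : q x = kernel_prob :> {measure set Y -> \bar R}.
Proof. exact: eq_measure. Qed.

End kernel_prob.

(** * Disintegration of integrals along a kernel *)

Section kernel_mixture.
Context (R : realType) (d d' : measure_display).
Context (X : measurableType d) (Y : measurableType d').
Variables (m : probability X R) (nu : {measure set Y -> \bar R}).
Variable q : R.-spker X ~> Y.
Hypothesis qm : (forall A, measurable A -> \int[m]_x q x A = nu A)%E.

(** Presenting m as a constant kernel on [unit] turns this into the integral formula for a
    composition of kernels. The generality in m and nu serves three cases: an invariant measure, a
    product of two kernels started at a point, and the weighted mixture behind the adjoint. *)
Lemma integral_mixture (h : Y -> \bar R) :
  (forall y, 0 <= h y)%E -> measurable_fun [set: Y] h ->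
  (\int[m]_x \int[q x]_y h y = \int[nu]_y h y)%E.
Proof.
move=> h0 mh.
pose c : unit -> pprobability X R := fun=> m.
have mc : measurable_fun [set: unit] c by exact: measurable_cst.
pose l := kprobability mc.
pose k : R.-spker (unit * X) ~> Y := kernel.kernel_snd q.
have := integral_kcomp l k tt h0 mh.
rewrite /= => <-; apply: eq_measure_integral => A mA _.
by rewrite -qm.
Qed.

Lemma measurable_integral_kernel (h : Y -> \bar R) :
  (forall y, 0 <= h y)%E -> measurable_fun [set: Y] h ->
  measurable_fun [set: X] (fun x => \int[q x]_y h y)%E.
Proof.
by move=> h0 mh; apply: measurable_fun_integral_kernel => // U mU; exact: measurable_kernel.
Qed.

Lemma ae_mixture (P : Y -> Prop) :
  {ae nu, forall y, P y} -> {ae m, forall x, {ae q x, forall y, P y}}.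
Proof.
move=> [N [mN N0 PN]].
have : (\int[m]_x `|q x N| = 0)%E.
  by rewrite -[RHS]N0 -qm//; apply: eq_integral => x _; rewrite gee0_abs.
move/(ae_eq_integral_abs m measurableT (measurable_kernel q N mN)).
by apply: filterS => x /(_ I) /= qN; exists N.
Qed.

Lemma integral_mixture_fin (h : Y -> \bar R) :
  (forall y, 0 <= h y)%E -> measurable_fun [set: Y] h ->
  (\int[nu]_y h y < +oo)%E -> {ae m, forall x, (\int[q x]_y h y < +oo)%E}.
Proof.
move=> h0 mh hfin.
have : m.-integrable setT (fun x => \int[q x]_y h y)%E.
  apply/integrableP; split; first exact: measurable_integral_kernel.
  under eq_integral do rewrite gee0_abs ?integral_ge0//.
  by rewrite integral_mixture.
move/(integrable_ae measurableT).
by apply: filterS => x /(_ I); rewrite ge0_fin_numE// integral_ge0.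
Qed.

Lemma measurable_Rintegral_kernel (f : Y -> R) : measurable_fun [set: Y] f ->
  measurable_fun [set: X] (fun x => \int[q x]_y f y).
Proof.
move=> mf; apply/measurableT_comp => //.
under eq_fun do rewrite integralE.
have mf' : measurable_fun [set: Y] (EFin \o f) by exact/measurable_EFinP.
apply: emeasurable_funB; apply: measurable_integral_kernel => //.
- exact: measurable_funepos.
- exact: measurable_funeneg.
Qed.

(** At some x, f may fail to be q(x, .)-integrable. The positive and negative parts are mixed
    separately; both have finite integrals under almost every q(x, .), and there [fine] loses
    nothing. *)
Lemma Rintegral_mixture (f : Y -> R) : nu.-integrable setT (EFin \o f) ->
  \int[m]_x \int[q x]_y f y = \int[nu]_y f y.
Proof.
move=> fi.
have mf : measurable_fun [set: Y] (EFin \o f) by exact: measurable_int fi.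
have mf' : measurable_fun [set: Y] f by exact/measurable_EFinP.
have ip : m.-integrable setT (fun x => \int[q x]_y (EFin \o f)^\+ y)%E.
  apply/integrableP; split.
    by apply: measurable_integral_kernel => //; exact: measurable_funepos.
  under eq_integral do rewrite gee0_abs ?integral_ge0//.
  rewrite integral_mixture//; last exact: measurable_funepos.
  exact: integral_funepos_lt_pinfty.
have im : m.-integrable setT (fun x => \int[q x]_y (EFin \o f)^\- y)%E.
  apply/integrableP; split.
    by apply: measurable_integral_kernel => //; exact: measurable_funeneg.
  under eq_integral do rewrite gee0_abs ?integral_ge0//.
  rewrite integral_mixture//; last exact: measurable_funeneg.
  exact: integral_funeneg_lt_pinfty.
rewrite /Rintegral; congr fine.
transitivity (\int[m]_x (\int[q x]_y (EFin \o f)^\+ y - \int[q x]_y (EFin \o f)^\- y))%E.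
  apply: ae_eq_integral => //.
  - exact/measurable_EFinP/measurable_Rintegral_kernel.
  - by apply: emeasurable_funB; [exact: measurable_int ip|exact: measurable_int im].
  have := integrable_ae measurableT ip; have := integrable_ae measurableT im.
  apply: filterS2 => x /(_ I) imx /(_ I) ipx _.
  by rewrite [X in fine X]integralE fineK// fin_numB ipx imx.
rewrite integralB// !integral_mixture//.
- by rewrite [RHS]integralE.
- exact: measurable_funeneg.
- exact: measurable_funepos.
Qed.

End kernel_mixture.

(** * The Markov operator on L^2(pi) *)

Section markov_operator.
Context (R : realType) (d : measure_display) (Omega : measurableType d).
Variables (q : R.-pker Omega ~> Omega) (pi : probability Omega R).
Hypothesis inv : invariant_measure q pi.
Implicit Types f g : Omega -> R.

Lemma markov_opE f x : markov_op q f x = \int[kernel_prob q x]_y f y.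
Proof. by rewrite /markov_op kernel_probE. Qed.

Lemma Lfun2_kernel f : f \in Lfun pi 2%:E ->
  {ae pi, forall x, f \in Lfun (kernel_prob q x) 2%:E}.
Proof.
move=> /Lfun2P[mf f2].
have : {ae pi, forall x, (\int[q x]_y (f y ^+ 2)%:E < +oo)%E}.
  apply: (integral_mixture_fin inv) f2 => //.
    by move=> y; rewrite lee_fin sqr_ge0.
  exact/measurable_EFinP/measurable_funX.
by apply: filterS => x fx; apply/Lfun2P; split => //; rewrite -kernel_probE.
Qed.

Lemma ae_kernel (P : Omega -> Prop) : {ae pi, forall y, P y} ->
  {ae pi, forall x, {ae kernel_prob q x, forall y, P y}}.
Proof.
move=> /(ae_mixture inv); apply: filterS => x [N [mN N0 NP]].
by exists N; split => //; rewrite -kernel_probE.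
Qed.

Lemma measurable_markov_op f : measurable_fun [set: Omega] f ->
  measurable_fun [set: Omega] (markov_op q f).
Proof. exact: measurable_Rintegral_kernel. Qed.

(** Jensen under q(x, .), then invariance, which turns the averaged second moment back into that of
    f. *)
Lemma Lfun2_markov_op f : f \in Lfun pi 2%:E ->
  markov_op q f \in Lfun pi 2%:E /\
  \int[pi]_x (markov_op q f x ^+ 2) <= \int[pi]_x (f x ^+ 2).
Proof.
move=> fL; have mf := Lfun2_measurable fL.
have le2 : (\int[pi]_x (markov_op q f x ^+ 2)%:E <= \int[pi]_x (f x ^+ 2)%:E)%E.
  rewrite -[leRHS](integral_mixture inv); last 2 first.
    by move=> y; rewrite lee_fin sqr_ge0.
    exact/measurable_EFinP/measurable_funX.
  apply: ae_ge0_le_integral => //.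
  - by move=> x _; rewrite lee_fin sqr_ge0.
  - exact/measurable_EFinP/measurable_funX/measurable_markov_op.
  - by move=> x _; apply: integral_ge0 => y _; rewrite lee_fin sqr_ge0.
  - apply: measurable_integral_kernel => //.
      by move=> y; rewrite lee_fin sqr_ge0.
    exact/measurable_EFinP/measurable_funX.
  apply: filterS (Lfun2_kernel fL) => x fx _.
  by rewrite markov_opE /= kernel_probE Lfun2_integral_sqr// lee_fin sqr_Rintegral_le.
have Lq : markov_op q f \in Lfun pi 2%:E.
  apply/Lfun2P; split; first exact: measurable_markov_op.
  by rewrite (le_lt_trans le2)//; case/Lfun2P : fL.
split => //; move: le2.
by rewrite !Lfun2_integral_sqr.
Qed.

Lemma Rintegral_markov_op f : f \in Lfun pi 2%:E ->
  \int[pi]_x markov_op q f x = \int[pi]_x f x.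
Proof. by move=> /Lfun2_integrable; exact: Rintegral_mixture. Qed.

(** Only almost everywhere: additivity of [Rintegral] requires f and g to be q(x, .)-integrable. *)
Lemma markov_op_linear a b f g : f \in Lfun pi 2%:E -> g \in Lfun pi 2%:E ->
  {ae pi, forall x, markov_op q (fun y => a * f y + b * g y) x =
                    a * markov_op q f x + b * markov_op q g x}.
Proof.
move=> /Lfun2_kernel fL /Lfun2_kernel gL; apply: filterS2 fL gL => x fL gL.
rewrite !markov_opE RintegralD ?RintegralZl//.
- exact: Lfun2_integrable.
- exact: Lfun2_integrable.
- exact/Lfun2_integrable/Lfun2Z.
- exact/Lfun2_integrable/Lfun2Z.
Qed.

Lemma markov_op_ae_eq f g :
  measurable_fun [set: Omega] f -> measurable_fun [set: Omega] g ->
  {ae pi, forall x, f x = g x} ->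
  {ae pi, forall x, markov_op q f x = markov_op q g x}.
Proof.
move=> mf mg /ae_kernel; apply: filterS => x fg.
by rewrite !markov_opE; exact: ae_eq_Rintegral.
Qed.

Lemma markov_opDc f c : f \in Lfun pi 2%:E ->
  {ae pi, forall x, markov_op q (fun y => f y + c) x = markov_op q f x + c}.
Proof.
move=> /Lfun2_kernel; apply: filterS => x fL.
rewrite !markov_opE RintegralD ?Rintegral_cst1//.
- exact: Lfun2_integrable.
- exact: (Lfun2_integrable (Lfun2_cst _ c)).
Qed.

Lemma L20_markov_op f : L20 pi f -> L20 pi (markov_op q f).
Proof.
move=> [fL f0]; split; first by have [] := Lfun2_markov_op fL.
by rewrite Rintegral_markov_op.
Qed.

Lemma markov_op_indic A x : measurable A -> markov_op q \1_A x = fine (q x A).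
Proof. by move=> mA; rewrite /markov_op /Rintegral integral_indic// setIT. Qed.

End markov_operator.

(** * Powers of the kernel *)

Section kernel_composition.
Context (R : realType) (d : measure_display) (Omega : measurableType d).
Implicit Types p q : R.-pker Omega ~> Omega.

(** One step of p, then one step of q. The instances below upgrade this composition to a probability
    kernel, the type over which [markov_op] and invariance are stated. *)
Definition kernel_mul p q : Omega -> {measure set Omega -> \bar R} :=
  mkcomp_noparam p q.

HB.instance Definition _ p q := SubProbabilityKernel.on (kernel_mul p q).

Let kernel_mul_prob p q x : kernel_mul p q x [set: Omega] = 1%E.
Proof.
rewrite /kernel_mul /mkcomp_noparam/= /kcomp_noparam.
under eq_integral do rewrite prob_kernel.
by rewrite integral_cst// mul1e prob_kernel.
Qed.

HB.instance Definition _ p q :=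
  isProbabilityKernel.Build _ _ _ _ _ (kernel_mul p q) (kernel_mul_prob p q).

Fixpoint kernel_pow p (n : nat) : R.-pker Omega ~> Omega :=
  if n is n'.+1 then kernel_mul p (kernel_pow p n')
  else kdirac (@measurable_id _ Omega setT).

Variables (p : R.-pker Omega ~> Omega) (pi : probability Omega R).
Hypothesis inv : invariant_measure p pi.

Lemma invariant_kernel_mul q : invariant_measure q pi ->
  invariant_measure (kernel_mul p q) pi.
Proof.
move=> invq A mA; rewrite -(invq A mA).
rewrite -[RHS](integral_mixture inv)//; exact: measurable_kernel.
Qed.

Lemma invariant_kernel_pow n : invariant_measure (kernel_pow p n) pi.
Proof.
elim: n => [|n IH] /=; last exact: invariant_kernel_mul.
move=> A mA /=; rewrite /kdirac /dirac/=.
by rewrite (integral_indic pi measurableT mA) setIT.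
Qed.

Lemma markov_op_mul q f : invariant_measure q pi -> f \in Lfun pi 2%:E ->
  {ae pi, forall x, markov_op (kernel_mul p q) f x = markov_op p (markov_op q f) x}.
Proof.
move=> invq fL.
have := Lfun2_kernel (invariant_kernel_mul invq) fL.
apply: filterS => x /Lfun2_integrable fx.
rewrite markov_opE [RHS]markov_opE; apply/esym.
by apply: Rintegral_mixture.
Qed.

Lemma iter_Lfun2 n f : f \in Lfun pi 2%:E -> iter n (markov_op p) f \in Lfun pi 2%:E.
Proof. by move=> fL; elim: n => //= n; case/(Lfun2_markov_op inv). Qed.

Lemma iter_L20 n f : L20 pi f -> L20 pi (iter n (markov_op p) f).
Proof. by move=> fL; elim: n => //= n; exact: L20_markov_op. Qed.

(** Lets n steps of p be treated as one step of a single kernel, so that the Cheeger estimate is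
    needed for one step only. *)
Lemma iter_markov_op n f : f \in Lfun pi 2%:E ->
  {ae pi, forall x, iter n (markov_op p) f x = markov_op (kernel_pow p n) f x}.
Proof.
move=> fL; elim: n => [|n IH] /=.
  apply: aeW => x; rewrite /markov_op /Rintegral.
  rewrite /= /kdirac integral_dirac//= ?diracT ?mul1e//.
    by rewrite indicT mul1r.
  exact/measurable_EFinP/(Lfun2_measurable fL).
have invn := invariant_kernel_pow n.
have H1 := markov_op_mul invn fL.
have H2 : {ae pi, forall x, markov_op p (iter n (markov_op p) f) x =
    markov_op p (markov_op (kernel_pow p n) f) x}.
  apply: (markov_op_ae_eq inv) => //.
  - exact/Lfun2_measurable/iter_Lfun2.
  - by apply: measurable_markov_op; exact: Lfun2_measurable fL.
by apply: filterS2 H1 H2 => x -> ->.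
Qed.

End kernel_composition.

(** * Adjoints as Radon-Nikodym densities *)

Section ae_order.
Context (R : realType) (d : measure_display) (T : measurableType d).
Variable m : probability T R.
Implicit Types f g : T -> R.

Lemma integrableM_indic f A : measurable A -> m.-integrable setT (EFin \o f) ->
  m.-integrable setT (EFin \o (fun x => \1_A x * f x)).
Proof.
move=> mA fi; apply: (le_integrable measurableT _ _ fi).
  apply/measurable_EFinP/measurable_funM; first exact: measurable_indic.
  exact/measurable_EFinP/(measurable_int m).
move=> x _ /=; rewrite lee_fin normrM indicE; case: (_ \in _).
  by rewrite normr1 mul1r.
by rewrite normr0 mul0r.
Qed.

(** Tested on A = {g < f}: the function 1_A (f - g) is nonnegative with integral at most 0. *)
Lemma ae_le_Rintegral f g :
  m.-integrable setT (EFin \o f) -> m.-integrable setT (EFin \o g) ->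
  (forall A, measurable A -> \int[m]_x (\1_A x * f x) <= \int[m]_x (\1_A x * g x)) ->
  {ae m, forall x, f x <= g x}.
Proof.
move=> fi gi fg.
have mf : measurable_fun [set: T] f by exact/measurable_EFinP/(measurable_int m).
have mg : measurable_fun [set: T] g by exact/measurable_EFinP/(measurable_int m).
pose A := [set x | g x < f x].
have mA : measurable A by rewrite -[A]setTI; exact: measurable_fun_ltr.
pose u x := \1_A x * f x - \1_A x * g x.
have u0 x : 0 <= u x.
  rewrite /u -mulrBr indicE; case: (boolP (x \in A)) => [/set_mem|]; rewrite ?mul0r//.
  by rewrite /A/= mul1r subr_ge0 => /ltW.
have iA := integrableM_indic mA fi; have iB := integrableM_indic mA gi.
have ui : m.-integrable setT (EFin \o u).
  by have := integrableB measurableT iA iB; apply: eq_integrable.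
have : \int[m]_x u x = 0.
  apply/eqP; rewrite eq_le Rintegral_ge0 ?andbT//.
  by rewrite /u RintegralB// subr_le0; exact: fg.
move=> u1.
have : (\int[m]_x `|(EFin \o u) x| = 0)%E.
  under eq_integral do rewrite /= ger0_norm//.
  by rewrite -[LHS]fineK ?integrable_fin_num//; congr EFin.
move/(ae_eq_integral_abs m measurableT (measurable_int m ui)).
apply: filterS => x /(_ I) /= [] ux.
rewrite leNgt; apply/negP => gf; move: ux; rewrite /u indicE mem_set// !mul1r.
by move/eqP; rewrite subr_eq0 => /eqP E; move: gf; rewrite E ltxx.
Qed.

End ae_order.

Section weighted_mixture.
Context (R : realType) (d : measure_display) (Omega : measurableType d).
Variables (q : R.-pker Omega ~> Omega) (pi : probability Omega R).
Variable g : Omega -> R.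
Hypothesis mg : measurable_fun [set: Omega] g.
Hypothesis g0 : forall x, 0 <= g x.
Hypothesis g1 : forall x, g x <= 1.

(** Averaged over pi, it gives the measure taking A to the integral of g(x) q(x, A), that is, to the
    scalar product of q 1_A with g. The density of this measure is the adjoint applied to g. The
    bound g <= 1 keeps the kernel sub-probabilistic. *)
Definition weighted_kernel (x : Omega) : {measure set Omega -> \bar R} :=
  mscale (NngNum (g0 x)) (q x).

Let measurable_weighted_kernel U : measurable U ->
  measurable_fun [set: Omega] (weighted_kernel ^~ U).
Proof.
move=> mU; rewrite /weighted_kernel/= /mscale/=.
apply: emeasurable_funM; first exact/measurable_EFinP.
exact: measurable_kernel.
Qed.

HB.instance Definition _ :=
  isKernel.Build _ _ _ _ _ weighted_kernel measurable_weighted_kernel.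

Let weighted_kernel_sprob :
  (ereal_sup [set weighted_kernel x [set: Omega] | x in [set: Omega]] <= 1)%E.
Proof.
apply: ge_ereal_sup => _ [x _ <-].
by rewrite /weighted_kernel/= /mscale/= prob_kernel mule1 lee_fin.
Qed.

HB.instance Definition _ := Kernel_isSubProbability.Build _ _ _ _ _
  weighted_kernel weighted_kernel_sprob.

Let base : unit -> pprobability Omega R := fun=> pi.
Let mbase : measurable_fun [set: unit] base. Proof. exact: measurable_cst. Qed.

(** Encoded as a composition of kernels evaluated at [tt], so as to inherit the structure of a
    measure; the expected integral formula then holds by conversion. *)
Definition weighted_mixture : set Omega -> \bar R :=
  mkcomp (kprobability mbase) (kernel.kernel_snd weighted_kernel) tt.

HB.instance Definition _ := Measure.on weighted_mixture.

Lemma weighted_mixtureE A : weighted_mixture A = (\int[pi]_x weighted_kernel x A)%E.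
Proof. by []. Qed.

Let weighted_mixture_fin : fin_num_fun weighted_mixture.
Proof.
move=> A mA; rewrite ge0_fin_numE// (@le_lt_trans _ _ (weighted_mixture setT))//.
  by apply: le_measure; rewrite ?inE.
rewrite weighted_mixtureE (@le_lt_trans _ _ (\int[pi]__ 1)%E)//; last first.
  by rewrite integral_cst//= probability_setT mule1 ltry.
apply: ge0_le_integral => //; first exact: measurable_weighted_kernel.
move=> x _; rewrite /weighted_kernel/= /mscale/=.
by rewrite prob_kernel mule1 lee_fin.
Qed.

HB.instance Definition _ :=
  Measure_isFinite.Build _ _ _ weighted_mixture weighted_mixture_fin.

Hypothesis inv : invariant_measure q pi.

Lemma weighted_mixture_le A : measurable A -> (weighted_mixture A <= pi A)%E.
Proof.
move=> mA; rewrite weighted_mixtureE -(inv mA); apply: ge0_le_integral => //.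
- exact: measurable_weighted_kernel.
- exact: measurable_kernel.
move=> x _; rewrite /weighted_kernel/= /mscale/=.
by rewrite -[leRHS]mul1e lee_wpmul2r// lee_fin.
Qed.

End weighted_mixture.

Section adjoint_density.
Context (R : realType) (d : measure_display) (Omega : measurableType d).
Variables (q : R.-pker Omega ~> Omega) (pi : probability Omega R).
Hypothesis inv : invariant_measure q pi.
Implicit Types f g h : Omega -> R.

Lemma Rintegral_weighted_kernel g (g0 : forall x, 0 <= g x) f x :
  (q x).-integrable setT (EFin \o f) ->
  \int[weighted_kernel q g0 x]_y f y = g x * markov_op q f x.
Proof.
move=> fi; have mf := measurable_int _ fi.
rewrite /markov_op /Rintegral -[g x]/(fine (g x)%:E) -fineM//; last exact: integrable_fin_num.
congr fine; rewrite integralE.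
rewrite !ge0_integral_mscale//; [|exact: measurable_funeneg|exact: measurable_funepos].
rewrite -muleBr//=; last by rewrite fin_num_adde_defr//; exact: integrable_pos_fin_num.
by congr (_ * _)%E; rewrite [RHS]integralE.
Qed.

Lemma Lfun2_mixture_integrable g (mg : measurable_fun setT g)
    (g0 : forall x, 0 <= g x) (g1 : forall x, g x <= 1) f :
  f \in Lfun pi 2%:E -> (weighted_mixture q pi mg g0 g1).-integrable setT (EFin \o f).
Proof.
move=> /Lfun2_integrable fi; have /integrableP[mf foo] := fi.
apply/integrableP; split => //; apply: le_lt_trans foo.
pose k := weighted_kernel q g0.
have qm A : measurable A -> (\int[pi]_x k x A = weighted_mixture q pi mg g0 g1 A)%E.
  by [].
rewrite -(@integral_mixture _ _ _ _ _ pi _ (weighted_kernel q g0) qm)//; last first.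
  exact: measurableT_comp.
rewrite -[leRHS](integral_mixture inv)//; last exact: measurableT_comp.
apply: ge0_le_integral => //.
- by move=> x _; exact: integral_ge0.
- by apply: measurable_integral_kernel => //; exact: measurableT_comp.
- by apply: measurable_integral_kernel => //; exact: measurableT_comp.
move=> x _; rewrite ge0_integral_mscale//; last exact: measurableT_comp.
by rewrite -[leRHS]mul1e lee_wpmul2r ?lee_fin ?g1// integral_ge0.
Qed.

(** For every A the integral of 1_A h lies between 0 and the integral of q 1_A, which is pi(A) by
    invariance. The class of [0, 1]-valued functions is therefore stable under the adjoint, which
    allows the adjoint to be iterated. *)
Lemma adjoint_density_bounds g h : measurable_fun [set: Omega] g ->
  (forall x, 0 <= g x) -> (forall x, g x <= 1) ->
  pi.-integrable setT (EFin \o h) ->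
  (forall A, measurable A ->
    \int[pi]_x (markov_op q \1_A x * g x) = \int[pi]_x (\1_A x * h x)) ->
  {ae pi, forall x, 0 <= h x <= 1}.
Proof.
move=> mg g0 g1 hi fh.
have P1 A x : measurable A -> 0 <= markov_op q \1_A x.
  by move=> mA; rewrite markov_op_indic// fine_ge0.
have h0 : {ae pi, forall x, 0 <= h x}.
  apply: ae_le_Rintegral => //; first exact: (Lfun2_integrable (Lfun2_cst _ 0)).
  move=> A mA; rewrite -fh//; under eq_Rintegral do rewrite mulr0.
  by rewrite Rintegral_cst1 Rintegral_ge0// => x _; rewrite mulr_ge0// P1.
have h1 : {ae pi, forall x, h x <= 1}.
  apply: ae_le_Rintegral => //; first exact: (Lfun2_integrable (Lfun2_cst _ 1)).
  move=> A mA; rewrite -fh//; under [leRHS]eq_Rintegral do rewrite mulr1.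
  have AL := Lfun2_indic pi mA; have [PL _] := Lfun2_markov_op inv AL.
  rewrite -(Rintegral_markov_op inv AL); apply: le_Rintegral => //.
  - apply: (Lfun2_integrableM PL); apply: (@Lfun2_bounded _ _ _ _ 1) => //.
    by apply: aeW => x; rewrite ger0_norm.
  - exact: Lfun2_integrable.
  by move=> x _; rewrite ler_piMr// P1.
by apply: filterS2 h0 h1 => x -> ->.
Qed.

Lemma adjoint_exists g : measurable_fun [set: Omega] g ->
  (forall x, 0 <= g x) -> (forall x, g x <= 1) ->
  exists h, h \in Lfun pi 2%:E /\ forall f, f \in Lfun pi 2%:E ->
    \int[pi]_x (markov_op q f x * g x) = \int[pi]_x (f x * h x).
Proof.
move=> mg g0 g1.
pose nu : {finite_measure set Omega -> \bar R} := weighted_mixture q pi mg g0 g1.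
have numu : nu `<< pi.
  apply/null_content_dominatesP => A mA A0; apply/eqP; rewrite eq_le measure_ge0 andbT.
  by rewrite -A0; exact: weighted_mixture_le.
pose r := Radon_Nikodym (charge_of_finite_measure nu) pi.
have cov := Radon_Nikodym_change_of_variables numu measurableT.
have rfin x : r x \is a fin_num by exact: Radon_Nikodym_fin_num.
have ri : pi.-integrable setT r by exact: Radon_Nikodym_integrable.
pose h x := fine (r x).
have hr x : (h x)%:E = r x by rewrite fineK.
have hi : pi.-integrable setT (EFin \o h).
  by apply: eq_integrable ri => // x _ /=; rewrite hr.
have fh f : f \in Lfun pi 2%:E ->
    \int[pi]_x (markov_op q f x * g x) = \int[pi]_x (f x * h x).
  move=> fL; have nui := Lfun2_mixture_integrable mg g0 g1 fL.
  have := cov _ nui => covf.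
  (* Both sides are the integral of f against [nu]: disintegrated along the weighted kernel on the
     left, written with the density on the right. *)
  transitivity (\int[nu]_x f x).
    rewrite -(@Rintegral_mixture _ _ _ _ _ pi _ (weighted_kernel q g0) _ _ nui)//.
    apply: ae_eq_Rintegral.
    - apply: measurable_funM => //; apply: measurable_markov_op; exact: Lfun2_measurable fL.
    - apply: measurable_Rintegral_kernel; exact: Lfun2_measurable fL.
    apply: filterS (Lfun2_kernel inv fL) => x /Lfun2_integrable fx.
    by rewrite Rintegral_weighted_kernel 1?mulrC// kernel_probE.
  rewrite /Rintegral -covf; congr fine; apply: eq_integral => x _.
  by rewrite EFinM hr.
exists h; split => //.
have mh : measurable_fun [set: Omega] h.
  exact/measurable_EFinP/(measurable_int pi).
have := adjoint_density_bounds mg g0 g1 hi (fun A mA => fh _ (Lfun2_indic pi mA)).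
by move=> h01; apply: (@Lfun2_bounded _ _ _ _ 1) => //; apply: filterS h01 => x /andP[? ?];
  rewrite ger0_norm.
Qed.

Definition adjoint_spec g h := h \in Lfun pi 2%:E /\ forall f, f \in Lfun pi 2%:E ->
    \int[pi]_x (markov_op q f x * g x) = \int[pi]_x (f x * h x).

(** The bounds on g hold only almost everywhere, so g is first truncated to [0, 1]. The bounds on
    the adjoint follow from the duality identity alone, hence hold for whichever version [xget]
    selects. *)
Lemma adjointP g : measurable_fun [set: Omega] g ->
  {ae pi, forall x, 0 <= g x <= 1} ->
  adjoint_spec g (adjoint pi (markov_op q) g) /\
  {ae pi, forall x, 0 <= adjoint pi (markov_op q) g x <= 1}.
Proof.
move=> mg g01.
pose g' x := Num.min (Num.max (g x) 0) 1.
have mg' : measurable_fun [set: Omega] g'.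
  by apply: measurable_minr => //; exact: measurable_maxr.
have g'0 x : 0 <= g' x by rewrite /g' le_min le_max lexx orbT ler01.
have g'1 x : g' x <= 1 by rewrite /g' ge_min lexx orbT.
have gg' : {ae pi, forall x, g x = g' x}.
  apply: filterS g01 => x /andP[g0 g1].
  by rewrite /g' (max_idPl g0) (min_idPl g1).
have Pgg' f : f \in Lfun pi 2%:E -> \int[pi]_x (markov_op q f x * g x) =
    \int[pi]_x (markov_op q f x * g' x).
  move=> /Lfun2_measurable mf; apply: ae_eq_Rintegral.
  - by apply: measurable_funM => //; exact: measurable_markov_op.
  - by apply: measurable_funM => //; exact: measurable_markov_op.
  by apply: filterS gg' => x ->.
have [h [hL fh]] := adjoint_exists mg' g'0 g'1.
have spec : adjoint_spec g (adjoint pi (markov_op q) g).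
  apply: (@xgetPex _ (cst 0) (adjoint_spec g)); exists h; split => // f fL.
  by rewrite Pgg'// fh.
split => //; have [aL fa] := spec.
apply: (adjoint_density_bounds mg' g'0 g'1 (Lfun2_integrable aL)) => A mA.
by rewrite -Pgg' ?fa//; exact: Lfun2_indic.
Qed.

End adjoint_density.

(** * The isoperimetric constant as a ratio of flow to mass *)

Section isoperimetric.
Context (R : realType) (d : measure_display) (Omega : measurableType d).
Variables (p : R.-pker Omega ~> Omega) (pi : probability Omega R).
Hypothesis inv : invariant_measure p pi.
Implicit Types f g : Omega -> R.

Lemma iter_adjointP n g : g \in Lfun pi 2%:E -> {ae pi, forall x, 0 <= g x <= 1} ->
  [/\ iter n (adjoint pi (markov_op p)) g \in Lfun pi 2%:E,
      {ae pi, forall x, 0 <= iter n (adjoint pi (markov_op p)) g x <= 1} &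
      forall f, f \in Lfun pi 2%:E ->
        \int[pi]_x (iter n (markov_op p) f x * g x) =
        \int[pi]_x (f x * iter n (adjoint pi (markov_op p)) g x)].
Proof.
move=> gL g01; elim: n => [//|n [aL a01 fa]] /=.
have [[bL fb] b01] := adjointP inv (Lfun2_measurable aL) a01.
split => // f fL; rewrite -fb//.
by rewrite -fa ?(Lfun2_markov_op inv fL).1// -iterSr.
Qed.

(* The mass that two independent q-steps from a pi-distributed starting point
   separate across A. *)
Definition flow (q : R.-pker Omega ~> Omega) (A : set Omega) : R :=
  \int[pi]_x (fine (q x A) * (1 - fine (q x A))).

Lemma fine_kernelC (q : R.-pker Omega ~> Omega) A x : measurable A ->
  fine (q x (~` A)) = 1 - fine (q x A).
Proof.
by move=> mA; rewrite kernel_probE /= probability_setC// fineB// fin_num_measure.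
Qed.

Lemma fine_kernel01 (q : R.-pker Omega ~> Omega) A x : measurable A ->
  0 <= fine (q x A) <= 1.
Proof.
move=> mA; rewrite fine_ge0//= kernel_probE -lee_fin fineK ?fin_num_measure//.
exact: probability_le1.
Qed.

Lemma flow_ge0 q A : measurable A -> 0 <= flow q A.
Proof.
move=> mA; apply: Rintegral_ge0 => x _.
by have /andP[q0 q1] := fine_kernel01 q x mA; rewrite mulr_ge0// subr_ge0.
Qed.

Lemma integral_iter_adjoint n A : measurable A ->
  (\int[pi]_(x in A) (iter n (adjoint pi (markov_op p))
                        (iter n (markov_op p) \1_(~` A)) x)%:E =
   (flow (kernel_pow p n) A)%:E)%E.
Proof.
move=> mA; have mAC := measurableC mA.
have AL := Lfun2_indic pi mA; have ACL := Lfun2_indic pi mAC.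
set q := kernel_pow p n.
have qAC : {ae pi, forall x, iter n (markov_op p) \1_(~` A) x = 1 - fine (q x A)}.
  apply: filterS (iter_markov_op inv n ACL) => x ->.
  by rewrite markov_op_indic// fine_kernelC.
have qA : {ae pi, forall x, iter n (markov_op p) \1_A x = fine (q x A)}.
  by apply: filterS (iter_markov_op inv n AL) => x ->; rewrite markov_op_indic.
have gL := iter_Lfun2 inv n ACL.
have [|aL _ fa] := iter_adjointP n gL.
  apply: filterS qAC => x ->; have /andP[q0 q1] := fine_kernel01 q x mA.
  by rewrite subr_ge0 q1 lerBlDr lerDl q0.
have ai := integrableS measurableT mA (@subsetT _ _) (Lfun2_integrable aL).
rewrite -[LHS]fineK ?integrable_fin_num//; congr EFin.
rewrite -[LHS]/(Rintegral pi A _) Rintegral_mkcond.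
transitivity (\int[pi]_x (\1_A x * iter n (adjoint pi (markov_op p))
    (iter n (markov_op p) \1_(~` A)) x)).
  apply: eq_Rintegral => x _; rewrite patchE indicE.
  by case: (x \in A); rewrite ?mul1r// mul0r.
rewrite -fa//; apply: ae_eq_Rintegral.
- apply: measurable_funM; first exact: Lfun2_measurable (iter_Lfun2 inv n AL).
  exact: Lfun2_measurable gL.
- have mq : measurable_fun setT (fun x => fine (q x A)).
    apply: (measurableT_comp (f := fine)) => //; exact: measurable_kernel.
  by apply: measurable_funM => //; exact: measurable_funB.
by apply: filterS2 qA qAC => x -> ->.
Qed.

Lemma kPP_ratio n A : measurable A -> (0 < pi A < 1)%E ->
  ((\int[pi]_(x in A) (iter n (adjoint pi (markov_op p))
                        (iter n (markov_op p) \1_(~` A)) x)%:E)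
    / (pi A * pi (~` A)) =
   (flow (kernel_pow p n) A / (fine (pi A) * (1 - fine (pi A))))%:E)%E.
Proof.
move=> mA /andP[a0 a1]; rewrite integral_iter_adjoint// probability_setC//.
have aE : pi A = (fine (pi A))%:E by rewrite fineK// fin_num_measure.
move: a0 a1; rewrite aE !lte_fin /= => a0 a1.
by rewrite -EFinB -EFinM inver gt_eqF ?mulr_gt0 ?subr_gt0.
Qed.

(** Sets of measure 0 or 1 are excluded from the infimum but do occur as level sets; for them the
    left side vanishes. A real k below [kPP], instead of [kPP] itself, also covers an infinite
    constant. *)
Lemma isoperimetric_flow (k : R) n A : (k%:E <= kPP p pi n)%E -> measurable A ->
  k * (fine (pi A) * (1 - fine (pi A))) <= flow (kernel_pow p n) A.
Proof.
move=> kk mA; set a := fine (pi A).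
have [a01|] := boolP (0 < a < 1); last first.
  rewrite negb_and -!leNgt => a01; suff -> : a * (1 - a) = 0.
    by rewrite mulr0 flow_ge0.
  have a0 : 0 <= a by rewrite fine_ge0.
  have a1 : a <= 1 by rewrite -lee_fin fineK ?fin_num_measure// probability_le1.
  case/orP: a01 => [a0'|a1'].
    by rewrite (_ : a = 0) ?mul0r//; apply/eqP; rewrite eq_le a0'.
  by rewrite (_ : a = 1) ?subrr ?mulr0//; apply/eqP; rewrite eq_le a1.
have A01 : (0 < pi A < 1)%E.
  by rewrite -[pi A]fineK ?fin_num_measure// !lte_fin.
have kle : (k%:E <= (flow (kernel_pow p n) A / (a * (1 - a)))%:E)%E.
  apply: le_trans kk _; rewrite -kPP_ratio//; apply: ereal_inf_lbound.
  by exists A.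
case/andP: a01 => a0 a1; have aa : 0 < a * (1 - a) by rewrite mulr_gt0// subr_gt0.
by rewrite -ler_pdivlMr// -lee_fin.
Qed.

End isoperimetric.

(** * Cheeger's inequality *)

Section layer_cake.
Context (R : realType) (d : measure_display) (T : measurableType d).
Local Notation leb := (@lebesgue_measure R).
Local Notation RR := (measurableTypeR R).

(** At a fixed level t the variables x and y are independent, hence the product. Tonelli is used
    twice, once for y with x frozen and once for x. *)
Lemma tonelli_product (m : probability T R) (U V : T * RR -> \bar R) :
  measurable_fun [set: T * RR] U -> measurable_fun [set: T * RR] V ->
  (forall z, 0 <= U z)%E -> (forall z, 0 <= V z)%E ->
  (\int[m]_x \int[m]_y \int[leb]_t (U (x, t) * V (y, t)) =
   \int[leb]_t ((\int[m]_x U (x, t)) * (\int[m]_y V (y, t))))%E.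
Proof.
move=> mU mV U0 V0.
have mUt x : measurable_fun [set: RR] (fun t => U (x, t)).
  by apply: measurableT_comp => //; exact: pair1_measurable.
have mVy t : measurable_fun [set: T] (fun y => V (y, t)).
  by apply: measurableT_comp => //; exact: pair2_measurable.
have mUy t : measurable_fun [set: T] (fun y => U (y, t)).
  by apply: measurableT_comp => //; exact: pair2_measurable.
have mb : measurable_fun [set: RR] (fun t => \int[m]_y V (y, t))%E.
  exact: (@measurable_fun_fubini_tonelli_G _ _ T RR R m V).
have b0 t : (0 <= \int[m]_y V (y, t))%E by exact: integral_ge0.
transitivity (\int[m]_x \int[leb]_t (U (x, t) * (\int[m]_y V (y, t))))%E.
  apply: eq_integral => x _.
  pose W := (fun z : T * RR => U (x, z.2) * V z)%E.
  have mW : measurable_fun setT W.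
    by apply: emeasurable_funM => //; apply: (measurableT_comp (mUt x)).
  have W0 z : (0 <= W z)%E by rewrite /W mule_ge0.
  rewrite -[LHS]/(\int[m]_y \int[leb]_t W (y, t))%E fubini_tonelli//.
  by apply: eq_integral => t _; rewrite /W/= ge0_integralZl.
pose W := (fun z : T * RR => U z * (\int[m]_y V (y, z.2)))%E.
have mW : measurable_fun setT W.
  by apply: emeasurable_funM => //; apply: (measurableT_comp mb).
have W0 z : (0 <= W z)%E by rewrite /W mule_ge0.
rewrite -[LHS]/(\int[m]_y \int[leb]_t W (y, t))%E fubini_tonelli//.
by apply: eq_integral => t _; rewrite /W/= ge0_integralZr.
Qed.

Lemma measurable_tonelli_cross (U V : T * RR -> \bar R) :
  measurable_fun [set: T * RR] U -> measurable_fun [set: T * RR] V ->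
  (forall z, 0 <= U z)%E -> (forall z, 0 <= V z)%E ->
  measurable_fun [set: T * T]
    (fun z => \int[leb]_t (U (z.1, t) * V (z.2, t)))%E.
Proof.
move=> mU mV U0 V0.
pose W := (fun w : (T * T) * RR => U (w.1.1, w.2) * V (w.1.2, w.2))%E.
have mW : measurable_fun setT W.
  apply: emeasurable_funM.
    apply: (measurableT_comp mU); apply: measurable_fun_pair => //.
    exact: measurableT_comp.
  apply: (measurableT_comp mV); apply: measurable_fun_pair => //.
  exact: measurableT_comp.
apply: (@measurable_fun_fubini_tonelli_F _ _ _ RR R leb W) => //.
by move=> w; rewrite /W mule_ge0.
Qed.

Variable G : T -> R.
Hypothesis mG : measurable_fun [set: T] G.

(** The strict subgraph of G. Measurability jointly in the point and the level is derived from this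
    one set, whose sections are the superlevel sets [level t]. *)
Definition above : set (T * RR) := [set z | z.2 < G z.1].

Lemma measurable_above : measurable above.
Proof.
rewrite -[above]setTI; apply: (measurable_fun_ltr _ _ measurableT _ (Y := [set true])) => //.
by apply: (measurableT_comp mG).
Qed.

Lemma indic_above x (t : R) : \1_above (x, t) = (t < G x)%R%:R :> R.
Proof. by rewrite indicE; congr (_%:R); congr nat_of_bool; apply/idP/idP; rewrite inE. Qed.

Lemma indic_aboveC x (t : R) : \1_(~` above) (x, t) = (G x <= t)%R%:R :> R.
Proof.
rewrite indicE; congr (_%:R); congr nat_of_bool; rewrite leNgt.
by apply/idP/idP; rewrite inE /= => /negP.
Qed.

Lemma indic_itvco (a b t : R) : \1_`[a, b[ t = ((a <= t) && (t < b))%R%:R :> R.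
Proof. by rewrite indicE mem_setE in_itv. Qed.

(** At most one of the two intervals is nonempty. They are half-open to match the complementary
    conditions t < G x and G y <= t. *)
Lemma abs_sub_integral (a b : R) : (`|a - b|%:E =
  \int[leb]_t (\1_`[b, a[ t)%:E + \int[leb]_t (\1_`[a, b[ t)%:E)%E.
Proof.
rewrite !integral_indic//= !setIT !lebesgue_measure_itv/= !lte_fin.
have [ab|ba|->] := ltgtP a b.
- by rewrite add0e -EFinB ler0_norm ?opprB// subr_le0 ltW.
- by rewrite adde0 -EFinB ger0_norm// subr_ge0 ltW.
- by rewrite subrr normr0 adde0.
Qed.

(** The mean absolute difference of two independent copies of G under m. *)
Definition spread (m : probability T R) : \bar R :=
  (\int[m]_x \int[m]_y `|G x - G y|%:E)%E.

Lemma measurable_spread (m : probability T R) :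
  measurable_fun [set: T] (fun x => \int[m]_y (`|G x - G y|)%:E)%E.
Proof.
pose W (z : T * T) := (`|G z.1 - G z.2|)%:E.
have mW : measurable_fun setT W.
  apply/measurable_EFinP; apply: measurableT_comp => //.
  by apply: measurable_funB; [apply: (measurableT_comp mG)|apply: (measurableT_comp mG)].
by apply: (@measurable_fun_fubini_tonelli_F _ _ T T R m W) => // z; rewrite lee_fin.
Qed.

Definition level (t : R) : set T := [set x | t < G x].

Lemma measurable_level t : measurable (level t).
Proof.
rewrite -[level t]setTI.
by apply: (measurable_fun_ltr _ _ measurableT _ (Y := [set true])).
Qed.

Lemma integral_above (m : probability T R) t :
  (\int[m]_x (\1_above (x, t) : R)%:E = m (level t))%E.
Proof.
rewrite -[LHS]/(\int[m]_x (\1_(level t) x : R)%:E)%E.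
by rewrite integral_indic//= ?setIT//; exact: measurable_level.
Qed.

Lemma integral_aboveC (m : probability T R) t :
  (\int[m]_x (\1_(~` above) (x, t) : R)%:E = m (~` level t))%E.
Proof.
rewrite -[LHS]/(\int[m]_x (\1_(~` level t) x : R)%:E)%E.
by rewrite integral_indic//= ?setIT//; apply: measurableC; exact: measurable_level.
Qed.

Lemma measurable_indic_above : measurable_fun setT (fun z => (\1_above z : R)%:E).
Proof. by apply/measurable_EFinP/measurable_indic; exact: measurable_above. Qed.

Lemma measurable_indic_aboveC : measurable_fun setT (fun z => (\1_(~` above) z : R)%:E).
Proof.
by apply/measurable_EFinP/measurable_indic/measurableC; exact: measurable_above.
Qed.

Lemma measurable_measure_level (m : probability T R) :
  measurable_fun [set: RR] (fun t => m (level t) * m (~` level t))%E.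
Proof.
apply: emeasurable_funM.
  under eq_fun do rewrite -integral_above.
  by apply: (@measurable_fun_fubini_tonelli_G _ _ _ RR R m _ measurable_indic_above).
under eq_fun do rewrite -integral_aboveC.
by apply: (@measurable_fun_fubini_tonelli_G _ _ _ RR R m _ measurable_indic_aboveC).
Qed.

(** |G x - G y| is the measure of the set of levels t that separate x from y. There are two orders
    of separation, and independence gives both the same integral. *)
Lemma spreadE (m : probability T R) :
  spread m = (\int[leb]_t (m (level t) * m (~` level t)) +
              \int[leb]_t (m (level t) * m (~` level t)))%E.
Proof.
pose U z := (\1_above z : R)%:E; pose V z := (\1_(~` above) z : R)%:E.
have mU : measurable_fun setT U := measurable_indic_above.
have mV : measurable_fun setT V := measurable_indic_aboveC.
have U0 z : (0 <= U z)%E by rewrite lee_fin.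
have V0 z : (0 <= V z)%E by rewrite lee_fin.
have intU t : (\int[m]_x U (x, t) = m (level t))%E by exact: integral_above.
have intV t : (\int[m]_x V (x, t) = m (~` level t))%E by exact: integral_aboveC.
have UV := tonelli_product m mU mV U0 V0.
have VU := tonelli_product m mV mU V0 U0.
have {}UV : (\int[m]_x \int[m]_y \int[leb]_t (U (x, t) * V (y, t)) =
             \int[leb]_t (m (level t) * m (~` level t)))%E.
  by rewrite UV; apply: eq_integral => t _; rewrite intU intV.
have {}VU : (\int[m]_x \int[m]_y \int[leb]_t (V (x, t) * U (y, t)) =
             \int[leb]_t (m (level t) * m (~` level t)))%E.
  by rewrite VU; apply: eq_integral => t _; rewrite intU intV muleC.
have mUV := measurable_tonelli_cross mU mV U0 V0.
have mVU := measurable_tonelli_cross mV mU V0 U0.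
have UV0 (x y : T) : (0 <= \int[leb]_t (U (x, t) * V (y, t)))%E.
  by apply: integral_ge0 => t _; rewrite mule_ge0.
have VU0 (x y : T) : (0 <= \int[leb]_t (V (x, t) * U (y, t)))%E.
  by apply: integral_ge0 => t _; rewrite mule_ge0.
transitivity (\int[m]_x (\int[m]_y \int[leb]_t (U (x, t) * V (y, t)) +
                          \int[m]_y \int[leb]_t (V (x, t) * U (y, t))))%E.
  apply: eq_integral => x _; rewrite -ge0_integralD//.
  - apply: eq_integral => y _; rewrite abs_sub_integral; congr (_ + _)%E.
      apply: eq_integral => t _; rewrite /U /V -EFinM; congr EFin.
      by rewrite indic_above indic_aboveC indic_itvco -natrM mulnb andbC.
    apply: eq_integral => t _; rewrite /U /V -EFinM; congr EFin.
    by rewrite indic_above indic_aboveC indic_itvco -natrM mulnb.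
  - exact: (measurableT_comp mUV (@pair1_measurable _ _ _ _ x)).
  - exact: (measurableT_comp mVU (@pair1_measurable _ _ _ _ x)).
rewrite ge0_integralD//.
- by congr (_ + _)%E; [exact: UV|exact: VU].
- by move=> x _; exact: integral_ge0.
- by apply: (@measurable_fun_fubini_tonelli_F _ _ _ _ R m _ mUV) => z.
- by move=> x _; exact: integral_ge0.
- by apply: (@measurable_fun_fubini_tonelli_F _ _ _ _ R m _ mVU) => z.
Qed.

End layer_cake.

Section spread_kernel.
Context (R : realType) (d : measure_display) (Omega : measurableType d).
Variables (q : R.-pker Omega ~> Omega) (pi : probability Omega R).
Variable G : Omega -> R.
Hypothesis mG : measurable_fun [set: Omega] G.
Local Notation leb := (@lebesgue_measure R).
Local Notation RR := (measurableTypeR R).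

(** q with an idle second coordinate t. It serves to show that the q(x, .)-measure of a t-section is
    measurable jointly in x and t, as needed to exchange pi with the integral over levels. *)
Definition time_kernel : Omega * RR -> {measure set Omega -> \bar R} := q \o fst.

Let measurable_time_kernel U : measurable U ->
  measurable_fun [set: Omega * RR] (time_kernel ^~ U).
Proof.
by move=> mU; apply: (measurableT_comp (measurable_kernel q U mU)).
Qed.

HB.instance Definition _ :=
  isKernel.Build _ _ _ _ _ time_kernel measurable_time_kernel.

HB.instance Definition _ := Kernel_isProbability.Build _ _ _ _ _
  time_kernel (fun z => @prob_kernel _ _ _ _ _ q z.1).

Lemma measurable_kernel_section (S : set (Omega * RR)) : measurable S ->
  measurable_fun [set: Omega * RR] (fun z => q z.1 [set y | S (y, z.2)]).
Proof.
move=> mS.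
pose k (w : (Omega * RR) * Omega) : \bar R := (\1_S (w.2, w.1.2) : R)%:E.
have mk : measurable_fun setT k.
  apply/measurable_EFinP; apply: (measurableT_comp (f := (\1_S : Omega * RR -> R))).
    exact: measurable_indic.
  by apply: measurable_fun_pair => //; exact: measurableT_comp.
have k0 w : (0 <= k w)%E by rewrite lee_fin.
have := @measurable_fun_integral_finite_kernel _ _ _ _ R k time_kernel k0 mk.
apply: eq_measurable_fun => -[x t] _ /=.
rewrite -[LHS]/(\int[q x]_y (\1_[set y | S (y, t)] y : R)%:E)%E.
rewrite integral_indic ?setIT//.
rewrite -[X in measurable X]setTI.
exact: (@pair2_measurable _ _ _ _ t measurableT _ mS).
Qed.

Lemma flowE A : measurable A -> (\int[pi]_x (q x A * q x (~` A)))%E = (flow pi q A)%:E.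
Proof.
move=> mA.
have qL : (fun x => fine (q x A)) \in Lfun pi 2%:E.
  apply: (@Lfun2_bounded _ _ _ _ 1).
    apply: (measurableT_comp (f := fine)) => //; exact: measurable_kernel.
  by apply: aeW => x; have /andP[? ?] := fine_kernel01 q x mA; rewrite ger0_norm.
have ui := Lfun2_integrableM qL (Lfun2B (Lfun2_cst _ 1) qL).
rewrite fineK; last exact: integrable_fin_num ui.
apply: eq_integral => x _; rewrite -fine_kernelC// EFinM.
by rewrite !fineK// kernel_probE fin_num_measure//; exact: measurableC.
Qed.

Lemma measurable_spread_kernel :
  measurable_fun setT (fun x => spread G (kernel_prob q x)).
Proof.
pose w (z : Omega * RR) := (q z.1 (level G z.2) * q z.1 (~` level G z.2))%E.
have mw : measurable_fun setT w.
  apply: emeasurable_funM.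
    exact: measurable_kernel_section (measurable_above mG).
  exact: measurable_kernel_section (measurableC (measurable_above mG)).
have w0 z : (0 <= w z)%E by rewrite /w mule_ge0.
under eq_fun do rewrite spreadE//.
have mwx : measurable_fun setT (fun x => \int[leb]_t w (x, t))%E.
  exact: (@measurable_fun_fubini_tonelli_F _ _ _ RR R leb w).
exact: (emeasurable_funD mwx mwx).
Qed.

(** A co-area argument: [Hk] is applied to each superlevel set of G and integrated over the levels.
    The doubling in [spreadE] is the same on both sides. *)
Lemma spread_kernel (k : R) : 0 <= k ->
  (forall A, measurable A -> k * (fine (pi A) * (1 - fine (pi A))) <= flow pi q A) ->
  (k%:E * spread G pi <= \int[pi]_x spread G (kernel_prob q x))%E.
Proof.
move=> k0 Hk.
pose w (z : Omega * RR) := (q z.1 (level G z.2) * q z.1 (~` level G z.2))%E.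
have mw : measurable_fun setT w.
  apply: emeasurable_funM.
    exact: measurable_kernel_section (measurable_above mG).
  exact: measurable_kernel_section (measurableC (measurable_above mG)).
have w0 z : (0 <= w z)%E by rewrite /w mule_ge0.
have mwx : measurable_fun setT (fun x => \int[leb]_t w (x, t))%E.
  exact: (@measurable_fun_fubini_tonelli_F _ _ _ RR R leb w).
have wx0 x : (0 <= \int[leb]_t w (x, t))%E by exact: integral_ge0.
under eq_integral do rewrite spreadE//.
rewrite -[leRHS]/(\int[pi]_x (\int[leb]_t w (x, t) + \int[leb]_t w (x, t)))%E.
rewrite ge0_integralD// spreadE//.
have mpi := measurable_measure_level mG pi.
have P0 t : (0 <= pi (level G t) * pi (~` level G t))%E by rewrite mule_ge0.
have I0 : (0 <= \int[leb]_t (pi (level G t) * pi (~` level G t)))%E.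
  by apply: integral_ge0 => t _; exact: P0.
rewrite ge0_muleDr//.
suff le1 : (k%:E * \int[leb]_t (pi (level G t) * pi (~` level G t)) <=
    \int[pi]_x \int[leb]_t w (x, t))%E by exact: leeD.
rewrite fubini_tonelli//.
rewrite -ge0_integralZl//.
apply: ge0_le_integral => //.
- by move=> t _; apply: mule_ge0 => //; exact: P0.
- exact: measurable_funeM.
- exact: (@measurable_fun_fubini_tonelli_G _ _ _ RR R pi w).
move=> t _; rewrite /w/= flowE; last exact: measurable_level.
have mt := measurable_level mG t.
rewrite probability_setC// -[pi _]fineK ?fin_num_measure// -EFinB -!EFinM lee_fin.
exact: Hk.
Qed.

End spread_kernel.

Section spread_square.
Context (R : realType) (d : measure_display) (T : measurableType d).
Variable m : probability T R.
Implicit Types g : T -> R.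

Lemma integral_quadratic g (a b c : R) : g \in Lfun m 2%:E ->
  (\int[m]_x (a + b * g x + c * g x ^+ 2)%:E)%E =
  (a + b * \int[m]_x g x + c * \int[m]_x (g x ^+ 2))%:E.
Proof.
move=> gL.
have i1 := Lfun2_integrable (Lfun2D (Lfun2_cst m a) (Lfun2Z b gL)).
have i2 : m.-integrable setT (EFin \o (fun x => c * g x ^+ 2)).
  have := integrableZl measurableT c (Lfun2_integrable_sqr gL).
  by apply: eq_integrable.
have i12 : m.-integrable setT (EFin \o (fun x => a + b * g x + c * g x ^+ 2)).
  by have := integrableD measurableT i1 i2; apply: eq_integrable.
rewrite -[LHS]fineK; last exact: integrable_fin_num i12.
congr EFin; rewrite -[LHS]/(\int[m]_x (a + b * g x + c * g x ^+ 2)).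
rewrite RintegralD//; congr (_ + _).
  rewrite RintegralD//; last 2 first.
  - exact: (Lfun2_integrable (Lfun2_cst _ a)).
  - exact: (Lfun2_integrable (Lfun2Z b gL)).
  by rewrite Rintegral_cst1 RintegralZl//; exact: Lfun2_integrable.
by rewrite RintegralZl//; exact: Lfun2_integrable_sqr.
Qed.

(* AM-GM: |x^2 - y^2| <= lam/2 (x - y)^2 + (2 lam)^-1 (x + y)^2. *)
Lemma spread_square g (lam : R) : g \in Lfun m 2%:E -> 0 < lam ->
  (spread (fun x => g x ^+ 2)%R m + (lam * (\int[m]_x g x) ^+ 2)%:E <=
   ((lam + 2 / lam) * \int[m]_x (g x ^+ 2))%:E)%E.
Proof.
move=> gL l0; set M := \int[m]_x g x; set N := \int[m]_x (g x ^+ 2).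
have mg := Lfun2_measurable gL.
pose a := lam / 2; pose b := (2 * lam)^-1.
have a0 : 0 < a by rewrite divr_gt0.
have b0 : 0 < b by rewrite invr_gt0 mulr_gt0.
have ab : 4 * (a * b) = 1 by rewrite /a /b; field; rewrite gt_eqF.
have amgm (x y : R) : `|x ^+ 2 - y ^+ 2| <=
    (a + b) * x ^+ 2 + (2 * (b - a) * x) * y + (a + b) * y ^+ 2.
  rewrite (_ : (_ + _ + _) = a * (x - y) ^+ 2 + b * (x + y) ^+ 2); last by ring.
  (* With X = x - y, Y = x + y and 4ab = 1, b (2aX - Y)^2 = a X^2 - XY + b Y^2, and likewise with
     the opposite sign; moreover XY = x^2 - y^2. *)
  have h1 : 0 <= b * (2 * a * (x - y) - (x + y)) ^+ 2 by rewrite mulr_ge0 ?sqr_ge0// ltW.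
  have h2 : 0 <= b * (2 * a * (x - y) + (x + y)) ^+ 2 by rewrite mulr_ge0 ?sqr_ge0// ltW.
  have e1 : b * (2 * a * (x - y) - (x + y)) ^+ 2 =
     (4 * (a * b)) * (a * (x - y) ^+ 2) - (4 * (a * b)) * (x ^+ 2 - y ^+ 2) + b * (x + y) ^+ 2 by ring.
  have e2 : b * (2 * a * (x - y) + (x + y)) ^+ 2 =
     (4 * (a * b)) * (a * (x - y) ^+ 2) + (4 * (a * b)) * (x ^+ 2 - y ^+ 2) + b * (x + y) ^+ 2 by ring.
  move: h1 h2; rewrite e1 e2 ab !mul1r ler_norml => h1 h2.
  by apply/andP; split; lra.
have mg2 : measurable_fun setT (fun x => g x ^+ 2) by exact: measurable_funX.
have inner x : (\int[m]_y (`|g x ^+ 2 - g y ^+ 2|)%R%:E <=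
    ((a + b) * N + (2 * (b - a) * M) * g x + (a + b) * g x ^+ 2)%:E)%E.
  rewrite (_ : (_ + _ + _) = (a + b) * g x ^+ 2 + (2 * (b - a) * g x) * M + (a + b) * N); last by ring.
  rewrite -(integral_quadratic _ _ _ gL); apply: ge0_le_integral => //.
  - apply/measurable_EFinP; apply: measurableT_comp => //.
    by apply: measurable_funB.
  - apply/measurable_EFinP; apply: measurable_funD; last exact: measurable_funM.
    by apply: measurable_funD => //; exact: measurable_funM.
  - by move=> y _; rewrite lee_fin; exact: amgm.
have outer : (spread (fun x => g x ^+ 2)%R m <=
    (2 * (a + b) * N + 2 * (b - a) * M ^+ 2)%:E)%E.
  rewrite (_ : 2 * (a + b) * N + 2 * (b - a) * M ^+ 2 =
    (a + b) * N + (2 * (b - a) * M) * M + (a + b) * N); last by ring.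
  rewrite -(integral_quadratic _ _ _ gL); apply: ge0_le_integral => //.
  - by move=> x _; exact: integral_ge0.
  - exact: measurable_spread.
  - apply/measurable_EFinP; apply: measurable_funD; last exact: measurable_funM.
    by apply: measurable_funD => //; exact: measurable_funM.
have MN := sqr_Rintegral_le gL; rewrite -/M -/N in MN.
apply: (@le_trans _ _ ((2 * (a + b) * N + 2 * (b - a) * M ^+ 2)%:E + (lam * M ^+ 2)%:E)%E).
  by rewrite leeD2r.
rewrite -EFinD lee_fin.
rewrite (_ : lam = 2 * a); last by rewrite /a; field.
rewrite (_ : 2 / (2 * a) = 4 * b); last by rewrite /a /b; field; rewrite gt_eqF.
(* What remains is (lam + 1/lam) N + (1/lam) M^2; replacing M^2 by N turns 1/lam into 2/lam. *)
have := ler_wpM2l (ltW b0) MN.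
lra.
Qed.

End spread_square.

Section cheeger.
Context (R : realType) (d : measure_display) (Omega : measurableType d).
Variables (q : R.-pker Omega ~> Omega) (pi : probability Omega R).
Hypothesis inv : invariant_measure q pi.
Variable k : R.
Hypothesis k0 : 0 <= k.
Hypothesis kflow : forall A, measurable A ->
  k * (fine (pi A) * (1 - fine (pi A))) <= flow pi q A.
Implicit Types f g : Omega -> R.

Lemma spread_square_fin (m : probability Omega R) g : g \in Lfun m 2%:E ->
  spread (fun x => g x ^+ 2) m \is a fin_num.
Proof.
move=> gL; have := spread_square gL (@ltr01 R).
rewrite ge0_fin_numE; last by apply: integral_ge0 => x _; exact: integral_ge0.
by move=> h; rewrite (le_lt_trans _ (le_lt_trans h (ltry _)))// leeDl// lee_fin mulr_ge0// sqr_ge0.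
Qed.

(** [spread_square] under q(x, .), averaged over pi: the squared mean there is (q g)(x)^2, and
    [spread_kernel] bounds the averaged spread from below. *)
Lemma spread_markov_op g (lam : R) : g \in Lfun pi 2%:E -> 0 < lam ->
  k * fine (spread (fun x => g x ^+ 2) pi) + lam * \int[pi]_x (markov_op q g x ^+ 2) <=
  (lam + 2 / lam) * \int[pi]_x (g x ^+ 2).
Proof.
move=> gL l0; rewrite -lee_fin EFinD EFinM fineK ?spread_square_fin//.
have mg := Lfun2_measurable gL.
have mg2 : measurable_fun setT (fun x => g x ^+ 2) by exact: measurable_funX.
have [PL _] := Lfun2_markov_op inv gL.
have mP2 : measurable_fun setT (fun x => (markov_op q g x ^+ 2)%:E).
  exact/measurable_EFinP/measurable_funX/Lfun2_measurable/PL.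
have c0 : 0 <= lam + 2 / lam by rewrite addr_ge0 ?divr_ge0 ?ltW.
apply: (@le_trans _ _ (\int[pi]_x (spread (fun x => g x ^+ 2)%R (kernel_prob q x)
    + lam%:E * (markov_op q g x ^+ 2)%:E))%E).
  rewrite ge0_integralD//; last 4 first.
  - by move=> x _; apply: integral_ge0 => y _; exact: integral_ge0.
  - exact: measurable_spread_kernel.
  - by move=> x _; rewrite -EFinM lee_fin mulr_ge0 ?sqr_ge0// ltW.
  - exact: measurable_funeM.
  apply: leeD; first exact: spread_kernel.
  rewrite ge0_integralZl//; last 2 first.
  - by move=> x _; rewrite lee_fin sqr_ge0.
  - by rewrite lee_fin ltW.
  by rewrite Lfun2_integral_sqr// EFinM.
rewrite EFinM -Lfun2_integral_sqr//.
have mg2' : measurable_fun setT (fun x => (g x ^+ 2)%:E) by exact/measurable_EFinP.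
have g20 y : (0 <= (g y ^+ 2)%:E)%E by rewrite lee_fin sqr_ge0.
have E : (\int[pi]_x (g x ^+ 2)%:E = \int[pi]_x \int[q x]_y (g y ^+ 2)%:E)%E.
  by apply/esym; exact: (integral_mixture inv).
rewrite {}E -ge0_integralZl//; last 2 first.
- exact: measurable_integral_kernel.
- by move=> x _; exact: integral_ge0.
apply: ae_ge0_le_integral => //.
- move=> x _; rewrite adde_ge0//; last by rewrite -EFinM lee_fin mulr_ge0 ?sqr_ge0// ltW.
  by apply: integral_ge0 => y _; exact: integral_ge0.
- by apply: emeasurable_funD; [exact: measurable_spread_kernel|exact: measurable_funeM].
- by move=> x _; rewrite mule_ge0//; exact: integral_ge0.
- by apply: measurable_funeM; exact: measurable_integral_kernel.
apply: filterS (Lfun2_kernel inv gL) => x gx _.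
have := spread_square gx l0; rewrite markov_opE kernel_probE.
by rewrite Lfun2_integral_sqr// -!EFinM.
Qed.

(** The optimal lam would give w <= sqrt(8 v n). Choosing lam = w / (2v) leads to the same bound
    without square roots. *)
Lemma sqr_le_of_amgm (w v n : R) : 0 <= w -> 0 <= v -> 0 <= n ->
  (forall lam, 0 < lam -> w <= lam * v + 2 / lam * n) -> w ^+ 2 <= 8 * v * n.
Proof.
move=> w0 v0 n0 H.
have [->|wN0] := eqVneq w 0; first by rewrite expr0n /= !mulr_ge0.
have {wN0 w0}w0 : 0 < w by rewrite lt_neqAle eq_sym wN0.
have [vE|vN0] := eqVneq v 0.
  (* For v = 0 this lam makes the right side w * 2n / (2n + 1), which is below w: a
     contradiction. *)
  have l0 : 0 < (2 * n + 1) / w by rewrite divr_gt0// ltr_wpDl// mulr_ge0.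
  have := H _ l0; rewrite vE mulr0 add0r invf_div.
  rewrite (_ : 2 * (w / (2 * n + 1)) * n = w * (2 * n) / (2 * n + 1)); last by ring.
  rewrite ler_pdivlMr ?ltr_wpDl ?mulr_ge0// ler_pM2l//; lra.
have {vN0 v0}v0 : 0 < v by rewrite lt_neqAle eq_sym vN0.
have l0 : 0 < w / (2 * v) by rewrite divr_gt0// mulr_gt0.
have := H _ l0; rewrite invf_div.
rewrite (_ : w / (2 * v) * v = w / 2); last by field; rewrite gt_eqF.
rewrite (_ : 2 * (2 * v / w) * n = 4 * v * n / w); last by ring.
move=> h; have {}h : w / 2 <= 4 * v * n / w by lra.
by move: h; rewrite ler_pdivlMr//; lra.
Qed.

(** As f has mean 0, the shift adds c^2 to both |f|^2 and |q f|^2. It cancels from their difference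
    and survives only in the last factor, which leaves exactly the Lawler-Sokal quotient. *)
Lemma cheeger f c : L20 pi f ->
  (k * fine (spread (fun x => (f x + c) ^+ 2) pi)) ^+ 2 <=
  8 * (\int[pi]_x (f x ^+ 2) - \int[pi]_x (markov_op q f x ^+ 2)) *
      \int[pi]_x ((f x + c) ^+ 2).
Proof.
move=> [fL f0]; have [PL Ple] := Lfun2_markov_op inv fL.
have gL := Lfun2D fL (Lfun2_cst pi c).
have N := Rintegral_sqrDc c fL; rewrite f0 mulr0 addr0 in N.
have U := Rintegral_sqrDc c PL; rewrite Rintegral_markov_op// f0 mulr0 addr0 in U.
have {}U : \int[pi]_x (markov_op q (fun y => f y + c) x ^+ 2) =
    \int[pi]_x (markov_op q f x ^+ 2) + c ^+ 2.
  rewrite -U; apply: ae_eq_Rintegral.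
  - by apply: measurable_funX; apply: measurable_markov_op; exact: Lfun2_measurable gL.
  - by apply: measurable_funX; apply: measurable_funD => //; exact: Lfun2_measurable PL.
  by apply: filterS (markov_opDc inv c fL) => x ->.
apply: sqr_le_of_amgm.
- by rewrite mulr_ge0// fine_ge0//; apply: integral_ge0 => x _; exact: integral_ge0.
- by rewrite subr_ge0.
- by apply: Rintegral_ge0 => x _; exact: sqr_ge0.
have alg (w lam b n y : R) : w + lam * (b + y) <= (lam + 2 / lam) * (n + y) ->
  (lam + 2 / lam) * (n + y) - lam * (b + y) = lam * (n - b) + 2 / lam * (n + y) ->
  w <= lam * (n - b) + 2 / lam * (n + y) by move=> h <-; rewrite lerBrDr.
move=> lam l0; have := spread_markov_op gL l0.
by rewrite U N => /alg; apply; ring.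
Qed.

End cheeger.

(** * The law of f as a competitor in the Lawler-Sokal infimum *)

Section law.
Context (R : realType) (d : measure_display) (Omega : measurableType d).
Variables (pi : probability Omega R) (f : Omega -> R).
Hypothesis f201 : L201 pi f.

Let fL : f \in Lfun pi 2%:E. Proof. by case: f201 => -[]. Qed.
Let mf : measurable_fun [set: Omega] f. Proof. exact: Lfun2_measurable fL. Qed.

Let X : {mfun Omega >-> measurableTypeR R} :=
  HB.pack (f : Omega -> measurableTypeR R)
    (@isMeasurableFun.Build _ _ _ (measurableTypeR R) (f : Omega -> measurableTypeR R) mf).

Let mu : probability (measurableTypeR R) R := distribution pi X.

Let idL : (idfun : R -> R) \in Lfun mu 2%:E.
Proof.
apply/Lfun2P; split; first exact: measurable_id.
rewrite ge0_integral_distribution//; first by case/Lfun2P : fL.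
  by apply/measurable_EFinP; apply: measurable_funX; exact: measurable_id.
by move=> y; rewrite lee_fin sqr_ge0.
Qed.

Let expectation_sqrD c : ('E_mu[(fun x : R => (x + c) ^+ 2)%R] = (1 + c ^+ 2)%:E)%E.
Proof.
rewrite unlock ge0_integral_distribution//=; last 2 first.
- by apply/measurable_EFinP; apply: measurable_funX; exact: measurable_funD.
- by move=> y; rewrite lee_fin sqr_ge0.
rewrite (Lfun2_integral_sqr (Lfun2D fL (Lfun2_cst pi c))) Rintegral_sqrDc//.
by case: f201 => -[_ ->] ->; rewrite mulr0 addr0.
Qed.

Let variance_id : ('V_mu[(idfun : R -> R)] = 1)%E.
Proof.
rewrite varianceE//.
have -> : ('E_mu[(idfun : R -> R)] = 0)%E.
  have mid : measurable_fun setT (EFin \o (idfun : measurableTypeR R -> R)).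
    by apply/measurable_EFinP; exact: measurable_id.
  rewrite unlock (integral_distribution mid); last exact: Lfun2_integrable fL.
  rewrite -[LHS]fineK; last exact: integrable_fin_num (Lfun2_integrable fL).
  by congr EFin; case: f201 => -[].
rewrite expe2 mul0e sube0.
have := expectation_sqrD 0; rewrite expr0n addr0 => <-; congr expectation.
by apply/funext => x /=; rewrite addr0.
Qed.

Let integral_product c :
  (\int[(mu \x mu)%E]_w (`|(w.1 + c) ^+ 2 - (w.2 + c) ^+ 2|)%:E =
   spread (fun x => (f x + c) ^+ 2)%R pi)%E.
Proof.
pose W (w : measurableTypeR R * measurableTypeR R) : \bar R :=
  (`|((w.1 : R) + c) ^+ 2 - ((w.2 : R) + c) ^+ 2|)%:E.
have mW : measurable_fun setT W.
  apply/measurable_EFinP; apply: measurableT_comp => //; apply: measurable_funB;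
  by apply: measurable_funX; apply: measurable_funD.
have W0 w : (0 <= W w)%E by rewrite lee_fin.
rewrite -[LHS]/(\int[(mu \x mu)%E]_w W w)%E fubini_tonelli1//.
have mF := measurable_fun_fubini_tonelli_F (m2 := mu) W mW W0.
rewrite ge0_integral_distribution//; last by move=> y; exact: integral_ge0.
apply: eq_integral => x _; rewrite /fubini_F/= ge0_integral_distribution//.
exact: (measurableT_comp mW (@pair1_measurable _ _ _ _ _)).
Qed.

(** The law of f has variance 1, so it is admissible; its quotient at c is the squared spread
    divided by 1 + c^2. *)
Lemma lawler_sokal_le (M : R) :
  (forall c, fine (spread (fun x => (f x + c) ^+ 2) pi) ^+ 2 <=
             M * (1 + c ^+ 2)) ->
  lawler_sokal R <= M.
Proof.
move=> H; rewrite /lawler_sokal; set k := ereal_inf _.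
(* Needed because [fine] sends an infinite infimum to 0. *)
have M0 : 0 <= M.
  by have := H 0; rewrite expr0n addr0 mulr1; apply: le_trans; exact: sqr_ge0.
suff : (k <= M%:E)%E by case: k => //= r; rewrite lee_fin.
apply: ge_ereal_inf.
eexists; first by exists mu.
apply: ge_ereal_sup => _ [c _ <-].
rewrite integral_product expectation_sqrD inver gt_eqF ?ltr_wpDr ?sqr_ge0//.
have sfin := spread_square_fin (Lfun2D fL (Lfun2_cst pi c)).
rewrite -(fineK sfin) -EFin_expe -EFinM lee_fin ler_pdivrMr ?ltr_wpDr ?sqr_ge0//.
Qed.

End law.

Section law_bound.
Context (R : realType) (d : measure_display) (Omega : measurableType d).
Variables (q : R.-pker Omega ~> Omega) (pi : probability Omega R).
Hypothesis inv : invariant_measure q pi.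
Variable k : R.
Hypothesis k0 : 0 <= k.
Hypothesis kflow : forall A, measurable A ->
  k * (fine (pi A) * (1 - fine (pi A))) <= flow pi q A.

(** With V = 1 - |q f|^2, [cheeger] bounds the quotient of the law of f by 8 V / k^2 for all c at
    once; hence kappa <= 8 V / k^2. *)
Lemma cheeger_lawler_sokal f : L201 pi f ->
  \int[pi]_x (markov_op q f x ^+ 2) <= 1 - lawler_sokal R / 8 * k ^+ 2.
Proof.
move=> f201; have [fL0 f1] := f201.
have [_ Ple] := Lfun2_markov_op inv (proj1 fL0); rewrite f1 in Ple.
have [->|kN0] := eqVneq k 0; first by rewrite expr0n /= mulr0 subr0.
have kp : 0 < k by rewrite lt_neqAle eq_sym kN0.
have k2 : 0 < k ^+ 2 by rewrite exprn_gt0.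
have := @lawler_sokal_le R _ _ pi f f201
  (8 * (1 - \int[pi]_x (markov_op q f x ^+ 2)) / k ^+ 2).
set V := 1 - _ => H.
suff : lawler_sokal R <= 8 * V / k ^+ 2.
  by rewrite ler_pdivlMr// /V => h; lra.
apply: H => c; have := cheeger inv k0 kflow c fL0.
rewrite Rintegral_sqrDc ?(proj1 fL0)// f1 (proj2 fL0) mulr0 addr0 exprMn.
rewrite -/V => h; rewrite -(ler_pM2l k2); apply: le_trans h _.
by rewrite le_eqVlt; apply/orP; left; apply/eqP; field.
Qed.

End law_bound.

Section spread_bound.
Context (R : realType) (d : measure_display) (T : measurableType d).
Variable m : probability T R.

(** The triangle inequality for the integral in the inner variable. *)
Lemma spread_ge g : m.-integrable setT (EFin \o g) ->
  (\int[m]_x (`|g x - \int[m]_y g y|)%:E <= spread g m)%E.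
Proof.
move=> gi; have mg : measurable_fun setT g by exact/measurable_EFinP/(measurable_int m).
have ci c : m.-integrable setT (EFin \o (fun=> c : R)).
  exact: (Lfun2_integrable (Lfun2_cst m c)).
apply: ge0_le_integral => //.
- apply/measurable_EFinP; apply: measurableT_comp => //.
  exact: measurable_funB.
- exact: measurable_spread.
move=> x _.
have xi : m.-integrable setT (EFin \o (fun y => g x - g y)).
  by have := integrableB measurableT (ci (g x)) gi; apply: eq_integrable.
rewrite (_ : g x - _ = \int[m]_y (g x - g y)); last by rewrite RintegralB// Rintegral_cst1.
rewrite (EFin_normr_Rintegral measurableT xi).
exact: (@le_abse_integral _ _ _ m setT (EFin \o (fun y => g x - g y)) measurableT
  (measurable_int m xi)).
Qed.

(* Either c = 0 or c = 1 already certifies that the Lawler-Sokal quotient of a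
   centred law of variance one is at least 1/8. *)
Lemma spread_shift_ge f : L201 m f ->
  exists c : R, 1 + c ^+ 2 <= 8 * fine (spread (fun x => (f x + c) ^+ 2) m) ^+ 2.
Proof.
move=> [[fL f0] f1].
have fcL c := Lfun2D fL (Lfun2_cst m c).
have sq c : \int[m]_x ((f x + c) ^+ 2) = 1 + c ^+ 2.
  by rewrite Rintegral_sqrDc// f0 f1 mulr0 addr0.
have fin c := spread_square_fin (fcL c).
have mf := Lfun2_measurable fL.
pose u c x : R := `|(f x + c) ^+ 2 - (1 + c ^+ 2)|.
have mu c : measurable_fun setT (EFin \o u c).
  apply/measurable_EFinP; apply: measurableT_comp => //; apply: measurable_funB => //.
  by apply: measurable_funX; exact: measurable_funD.
have ge c : (\int[m]_x (u c x)%:E <= (fine (spread (fun x => (f x + c) ^+ 2)%R m))%:E)%E.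
  rewrite fineK//; apply: le_trans (spread_ge (Lfun2_integrable_sqr (fcL c))).
  by rewrite sq.
(* With y = f x: u 0 >= 1 - |y| and u 1 >= 2|y| - u 0, so 3 u 0 + u 1 >= 2 u 0 + 2|y| >= 2. *)
have u3 x : 2 <= 3 * u 0 x + u 1 x.
  rewrite /u; set y := f x.
  have -> : (y + 0) ^+ 2 - (1 + 0 ^+ 2) = y ^+ 2 - 1 by ring.
  have -> : (y + 1) ^+ 2 - (1 + 1 ^+ 2) = y ^+ 2 - 1 + 2 * y by ring.
  have h1 : 1 - `|y| <= `|y ^+ 2 - 1|.
    have [y1|y1] := lerP 1 `|y|.
      by apply: le_trans (normr_ge0 _); rewrite subr_le0.
    rewrite distrC -real_normK ?num_real//; apply: le_trans (ler_norm _).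
    by have := normr_ge0 y; nra.
  have h2 : 2 * `|y| - `|y ^+ 2 - 1| <= `|y ^+ 2 - 1 + 2 * y|.
    by rewrite -[X in X * `|y|]ger0_norm// -normrM [X in _ <= `|X|]addrC lerB_normD.
  by lra.
have B : 2 <= 3 * fine (spread (fun x => (f x + 0) ^+ 2) m) +
               fine (spread (fun x => (f x + 1) ^+ 2) m).
  rewrite -lee_fin [leRHS]EFinD EFinM.
  apply: (@le_trans _ _ (3%:E * \int[m]_x (u 0 x)%:E + \int[m]_x (u 1 x)%:E)%E); last first.
    by rewrite leeD// lee_wpmul2l// lee_fin.
  have u0 c x : (0 <= (u c x)%:E)%E by rewrite lee_fin normr_ge0.
  rewrite -ge0_integralZl//; last exact: mu.
  rewrite -ge0_integralD//; last 3 first.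
  - by move=> x _; rewrite mule_ge0.
  - by apply: measurable_funeM; exact: mu.
  - exact: mu.
  rewrite [leLHS](_ : _ = \int[m]__ 2%:E)%E; last by rewrite integral_cst//= probability_setT mule1.
  apply: ge0_le_integral => //.
  - by apply: emeasurable_funD; [apply: measurable_funeM; exact: mu|exact: mu].
  - by move=> x _; rewrite -EFinM -EFinD lee_fin.
(* If the spread at c = 0 is below 1/2, the one at c = 1 is at least 2 - 3/2 = 1/2. The factor 8 is
   what c = 1 requires: 1 + 1 = 8 (1/2)^2. *)
have [B0|B0] := lerP (1 / 2) (fine (spread (fun x => (f x + 0) ^+ 2) m)).
  exists 0; rewrite expr0n /=; move: B0; set x := fine _ => x2.
  by clear -x2; nra.
exists 1; move: B B0; set x := fine _; set y := fine _ => B x2.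
have y2 : 1 / 2 <= y by clear -B x2; lra.
by clear -y2; nra.
Qed.

End spread_bound.

Section cheeger_gap.
Context (R : realType) (d : measure_display) (Omega : measurableType d).
Variables (q : R.-pker Omega ~> Omega) (pi : probability Omega R).
Hypothesis inv : invariant_measure q pi.
Implicit Types f : Omega -> R.

(** 64 = 8 * 8, one factor from [cheeger] and one from [spread_shift_ge]. The bound is below 1 as
    soon as k > 0. *)
Lemma cheeger_gap (k : R) f : 0 <= k ->
  (forall A, measurable A -> k * (fine (pi A) * (1 - fine (pi A))) <= flow pi q A) ->
  L201 pi f -> \int[pi]_x (markov_op q f x ^+ 2) <= 1 - k ^+ 2 / 64.
Proof.
move=> k0 kflow f201; have [fL0 f1] := f201.
have [c cW] := spread_shift_ge f201.
have := cheeger inv k0 kflow c fL0.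
rewrite Rintegral_sqrDc ?(proj1 fL0)// f1 (proj2 fL0) mulr0 addr0 exprMn.
set W := fine _ ^+ 2 in cW *; set V := 1 - _ => h.
have c0 : 0 < 1 + c ^+ 2 by rewrite ltr_wpDr ?sqr_ge0.
suff : k ^+ 2 <= 64 * V by rewrite /V; lra.
rewrite -(ler_pM2r c0).
have : k ^+ 2 * (1 + c ^+ 2) <= k ^+ 2 * (8 * W) by rewrite ler_wpM2l ?sqr_ge0.
by move=> h'; lra.
Qed.

(** Homogeneity. A function of norm 0 cannot be normalised; for it the general contraction property
    of q gives the claim. *)
Lemma contraction_L201 (r : R) :
  (forall f, L201 pi f -> \int[pi]_x (markov_op q f x ^+ 2) <= r) ->
  forall f, L20 pi f ->
    \int[pi]_x (markov_op q f x ^+ 2) <= r * \int[pi]_x (f x ^+ 2).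
Proof.
move=> H f [fL f0]; have [PL Ple] := Lfun2_markov_op inv fL.
set N := \int[pi]_x (f x ^+ 2) in Ple *.
have N0 : 0 <= N by apply: Rintegral_ge0 => x _; exact: sqr_ge0.
have [NE|NN0] := eqVneq N 0; first by move: Ple; rewrite NE mulr0.
have {NN0}N0 : 0 < N by rewrite lt_neqAle eq_sym NN0.
pose c := (Num.sqrt N)^-1.
have c2 : c ^+ 2 = N^-1 by rewrite exprVn sqr_sqrtr// ltW.
have g201 : L201 pi (fun x => c * f x).
  split; last by rewrite Rintegral_sqrZ// c2 mulVf// gt_eqF.
  split; first exact: Lfun2Z.
  by rewrite RintegralZl ?f0 ?mulr0//; exact: Lfun2_integrable.
have := H _ g201.
suff -> : \int[pi]_x (markov_op q (fun y => c * f y) x ^+ 2) =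
    \int[pi]_x ((c * markov_op q f x) ^+ 2).
  by rewrite Rintegral_sqrZ// c2 mulrC ler_pdivrMr.
apply: ae_eq_Rintegral.
- by apply: measurable_funX; apply: measurable_markov_op; exact: Lfun2_measurable (Lfun2Z c fL).
- by apply: measurable_funX; apply: measurable_funM => //; exact: Lfun2_measurable PL.
have := markov_op_linear inv c 0 fL fL.
apply: filterS => x; rewrite mul0r addr0 => <-.
by congr (_ ^+ 2); congr (markov_op q _ x); apply/funext => y; rewrite mul0r addr0.
Qed.

End cheeger_gap.

Section iterates.
Context (R : realType) (d : measure_display) (Omega : measurableType d).
Variables (p : R.-pker Omega ~> Omega) (pi : probability Omega R).
Hypothesis inv : invariant_measure p pi.
Implicit Types f : Omega -> R.

Lemma Rintegral_iter_sqr n f : f \in Lfun pi 2%:E ->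
  \int[pi]_x (iter n (markov_op p) f x ^+ 2) =
  \int[pi]_x (markov_op (kernel_pow p n) f x ^+ 2).
Proof.
move=> fL; apply: ae_eq_Rintegral.
- by apply: measurable_funX; exact: Lfun2_measurable (iter_Lfun2 inv n fL).
- by apply: measurable_funX; apply: measurable_markov_op; exact: Lfun2_measurable fL.
by apply: filterS (iter_markov_op inv n fL) => x ->.
Qed.

(** Transfers a one-step estimate for p^n on normalised functions to P^n; it is used with the sharp
    constant and with the explicit one. *)
Lemma iter_contraction (rho k : R) n : (k%:E <= kPP p pi n)%E ->
  ((forall A, measurable A ->
     k * (fine (pi A) * (1 - fine (pi A))) <= flow pi (kernel_pow p n) A) ->
   forall f, L201 pi f ->
     \int[pi]_x (markov_op (kernel_pow p n) f x ^+ 2) <= rho) ->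
  forall f, L20 pi f ->
    \int[pi]_x (iter n (markov_op p) f x ^+ 2) <= rho * \int[pi]_x (f x ^+ 2).
Proof.
move=> kk H f fL; rewrite Rintegral_iter_sqr ?(proj1 fL)//.
apply: (contraction_L201 (invariant_kernel_pow inv n)) fL; apply: H => A mA.
exact: isoperimetric_flow.
Qed.

(* [kPP] is +oo if no set has measure in ]0, 1[; [fine] then gives 0. *)
Lemma kPP_contraction n f : (0 < kPP p pi n)%E -> L20 pi f ->
  \int[pi]_x (iter n (markov_op p) f x ^+ 2) <=
  (1 - lawler_sokal R / 8 * fine (kPP p pi n) ^+ 2) * \int[pi]_x (f x ^+ 2).
Proof.
move=> k0; have kk : ((fine (kPP p pi n))%:E <= kPP p pi n)%E.
  by move: k0; case: (kPP p pi n) => //= _; rewrite leey.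
apply: (iter_contraction kk) => kflow g g201.
apply: cheeger_lawler_sokal kflow _ g201; first exact: invariant_kernel_pow.
by rewrite fine_ge0// ltW.
Qed.

Lemma kPP_strict_contraction n : (0 < kPP p pi n)%E ->
  exists2 rho : R, rho < 1 & forall f, L20 pi f ->
  \int[pi]_x (iter n (markov_op p) f x ^+ 2) <= rho * \int[pi]_x (f x ^+ 2).
Proof.
(* [fine] would send an infinite constant to 0, so a positive real below it is taken instead, namely
   1. *)
move=> k0; have [k kp kk] : exists2 k : R, 0 < k & (k%:E <= kPP p pi n)%E.
  move: k0; case: (kPP p pi n) => // [r r0|_]; first by exists r.
  by exists 1; rewrite ?leey.
exists (1 - k ^+ 2 / 64); first by rewrite ltrBlDr ltrDl divr_gt0// exprn_gt0.
apply: (iter_contraction kk) => kflow g g201.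
by apply: cheeger_gap kflow g201 => //; [exact: invariant_kernel_pow|exact: ltW].
Qed.

End iterates.

(** * Spectral gap *)

Section powers.
Context (R : realType) (d : measure_display) (Omega : measurableType d).
Variables (p : R.-pker Omega ~> Omega) (pi : probability Omega R).
Hypothesis inv : invariant_measure p pi.
Implicit Types f : Omega -> R.
Local Notation P n := (iter n (markov_op p)).

Lemma iter_sqr_le n f : f \in Lfun pi 2%:E ->
  \int[pi]_x (P n f x ^+ 2) <= \int[pi]_x (f x ^+ 2).
Proof.
move=> fL; elim: n => //= n; apply: le_trans.
exact: (Lfun2_markov_op inv (iter_Lfun2 inv n fL)).2.
Qed.

(** Write j = (j %/ m) m + i with i < m. The full blocks contribute their powers of s and the i
    remaining steps contract. The missing s^i is compensated by t^m with t = max(1, 1/s), since (t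
    s)^i >= 1 and t^i <= t^m. *)
Lemma iter_power_bound (m : nat) (s : R) : (0 < m)%N -> 0 < s ->
  (forall f, L20 pi f ->
    \int[pi]_x (P m f x ^+ 2) <= (s ^+ m) ^+ 2 * \int[pi]_x (f x ^+ 2)) ->
  exists2 C : R, 0 < C & forall j f, L20 pi f ->
    \int[pi]_x (P j f x ^+ 2) <= (C * s ^+ j) ^+ 2 * \int[pi]_x (f x ^+ 2).
Proof.
move=> m0 s0 H.
pose t := Num.max 1 s^-1.
have t1 : 1 <= t by rewrite le_max lexx.
have t0 : 0 < t by rewrite (lt_le_trans ltr01).
have ts : 1 <= t * s.
  by rewrite -ler_pdivrMr// mul1r le_max lexx orbT.
exists (t ^+ m); first by rewrite exprn_gt0.
move=> j f fL; set N := \int[pi]_x (f x ^+ 2).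
have N0 : 0 <= N by apply: Rintegral_ge0 => x _; exact: sqr_ge0.
have Hq k : \int[pi]_x (P (k * m)%N f x ^+ 2) <= (s ^+ (k * m)) ^+ 2 * N.
  elim: k => [|k IH]; first by rewrite mul0n /= expr0 expr1n mul1r.
  rewrite mulSn iterD; apply: le_trans (H _ (iter_L20 inv _ fL)) _.
  by rewrite (exprD s m) exprMn -(mulrA (s ^+ m ^+ 2)) ler_wpM2l// sqr_ge0.
rewrite {1}(divn_eq j m) addnC iterD.
apply: le_trans (iter_sqr_le _ (proj1 (iter_L20 inv _ fL))) _.
apply: le_trans (Hq _) _; apply: ler_wpM2r => //.
have [s0' t0'] := (ltW s0, ltW t0).
rewrite ler_pXn2r ?nnegrE ?mulr_ge0 ?exprn_ge0//.
have -> : s ^+ j = s ^+ (j %/ m * m) * s ^+ (j %% m) by rewrite -exprD -divn_eq.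
rewrite mulrCA -[leLHS]mulr1 ler_pM2l ?exprn_gt0//.
apply: (@le_trans _ _ (t ^+ (j %% m) * s ^+ (j %% m))).
  by rewrite -exprMn exprn_ege1.
by rewrite ler_pM2r ?exprn_gt0// ler_weXn2l// ltnW// ltn_mod.
Qed.

(** The sequence inside [spectral_gap] for P, kept convertible to it. *)
Definition gap_seq (n : nat) : \bar R :=
  ereal_sup [set ('N[pi]_2%:E[EFin \o P n f] `^ (n%:R^-1))%E | f in L201 pi].

Lemma root_Lnorm2_le n f (s : R) : (0 < n)%N -> 0 <= s -> f \in Lfun pi 2%:E ->
  ('N[pi]_2%:E[EFin \o P n f] `^ (n%:R^-1) <= s%:E)%E =
  (\int[pi]_x (P n f x ^+ 2) <= (s ^+ n) ^+ 2).
Proof.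
move=> n0 s0 fL; rewrite Lnorm2E (Lfun2_integral_sqr (iter_Lfun2 inv n fL)).
set y := \int[pi]_x _; have y0 : 0 <= y by apply: Rintegral_ge0 => x _; exact: sqr_ge0.
rewrite !poweR_EFin lee_fin powR12_sqrt//.
set x := Num.sqrt y; have x0 : 0 <= x := sqrtr_ge0 y.
have nN0 : n%:R != 0 :> R by rewrite pnatr_eq0 -lt0n.
have xr : (x `^ n%:R^-1) ^+ n = x.
  by rewrite -powR_mulrn ?powR_ge0// -powRrM mulVf// powRr1.
have -> : (x `^ n%:R^-1 <= s) = (x <= s ^+ n).
  by rewrite -{2}xr ler_pXn2r ?nnegrE ?powR_ge0.
by rewrite -(sqr_sqrtr y0) ler_pXn2r ?nnegrE ?exprn_ge0.
Qed.

Lemma gap_seq_leP n (s : R) : (0 < n)%N -> 0 <= s ->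
  (gap_seq n <= s%:E)%E <->
  (forall f, L20 pi f ->
    \int[pi]_x (P n f x ^+ 2) <= (s ^+ n) ^+ 2 * \int[pi]_x (f x ^+ 2)).
Proof.
move=> n0 s0; split=> H.
  have invn := invariant_kernel_pow inv n.
  move=> f fL; rewrite Rintegral_iter_sqr ?(proj1 fL)//.
  apply: (contraction_L201 invn) fL => g [gL g1].
  rewrite -Rintegral_iter_sqr ?(proj1 gL)// -root_Lnorm2_le ?(proj1 gL)//.
  by apply: le_trans H; apply: ereal_sup_ubound; exists g.
apply: ge_ereal_sup => _ [f [fL f1] <-].
by rewrite root_Lnorm2_le ?(proj1 fL)// -[leRHS]mulr1 -f1; exact: H.
Qed.

(** The constant C of [iter_power_bound] is absorbed because C (s / s')^n tends to 0. Thus the upper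
    limit of the sequence is at most each of its terms with positive index. *)
Lemma gap_seq_eventually_le m (s s' : R) : (0 < m)%N -> 0 < s -> s < s' ->
  (gap_seq m <= s%:E)%E -> \forall n \near \oo, (gap_seq n <= s'%:E)%E.
Proof.
move=> m0 s0 ss' /(gap_seq_leP m0 (ltW s0)) /(iter_power_bound m0 s0)[C C0 HC].
have s'0 := lt_trans s0 ss'.
have z1 : `|s / s'| < 1 by rewrite ger0_norm ?divr_ge0 ?(ltW s0) ?(ltW s'0)// ltr_pdivrMr// mul1r.
have /cvgrPdist_lt /(_ C^-1) := cvg_expr z1.
rewrite invr_gt0 => /(_ C0) Cev; apply: filterS2 (nbhs_infty_gt 0) Cev => n n0.
have [[s0' C0'] s'0'] := (ltW s0, ltW C0, ltW s'0).
rewrite sub0r normrN ger0_norm ?exprn_ge0 ?divr_ge0// => Cn.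
apply/(gap_seq_leP n0 (ltW s'0)) => f fL; apply: le_trans (HC n f fL) _; apply: ler_wpM2r.
  by apply: Rintegral_ge0 => x _; exact: sqr_ge0.
rewrite ler_pXn2r ?nnegrE ?mulr_ge0 ?exprn_ge0//.
by move: Cn; rewrite expr_div_n ltr_pdivrMr ?exprn_gt0// mulrC ltr_pdivlMr// mulrC => /ltW.
Qed.

Lemma gap_seq_contraction_gap m (s : R) : (0 < m)%N -> 0 < s < 1 ->
  (gap_seq m <= s%:E)%E -> spectral_gap pi (markov_op p).
Proof.
move=> m0 /andP[s0 s1] ms.
change (exists2 l : \bar R, (l < 1)%E & gap_seq @ \oo --> l).
have [f0|fN0] := pselect (exists f, L201 pi f); last first.
  exists -oo%E; first by rewrite ltNyr.
  have E n : gap_seq n = -oo%E.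
    apply/eqP; rewrite -leeNy_eq; apply: ge_ereal_sup => _ [f fL <-].
    by case: fN0; exists f.
  by rewrite (eq_cvg _ _ E); exact: cvg_cst.
have gap0 n : (0 <= gap_seq n)%E.
  case: f0 => f fL; apply: le_ereal_sup_tmp; eexists; first by exists f.
  exact: poweR_ge0.
(* The limit is the infimum over n >= 1, as in Fekete's lemma. *)
pose b := ereal_inf [set gap_seq n | n in [set n | (0 < n)%N]].
have bs : (b <= s%:E)%E by apply: le_trans ms; apply: ereal_inf_lbound; exists m.
have b0 : (0 <= b)%E by apply: le_ereal_inf_tmp => _ [n _ <-].
have bfin : b \is a fin_num by rewrite ge0_fin_numE// (le_lt_trans bs) ?ltry.
exists b; first by rewrite (le_lt_trans bs)// lte_fin.
apply: limn_esup_le_cvg; last first.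
  case=> [|n]; last by apply: ereal_inf_lbound; exists n.+1.
  (* At index 0 the exponent is 0^-1 = 0 and every term of the supremum is 1, which still exceeds
     b. *)
  apply: (@le_trans _ _ 1%E); first by rewrite (le_trans bs)// lee_fin ltW.
  case: f0 => f fL; apply: le_ereal_sup_tmp; eexists; first by exists f.
  by rewrite invr0 poweRe0.
apply/lee_addgt0Pr => e e0.
have e2 : 0 < e / 2 by rewrite divr_gt0.
have [_ [n n0 <-] nlt] := lb_ereal_inf_adherent e2 bfin.
have bE : b = (fine b)%:E by rewrite fineK.
have fb0 : 0 <= fine b by rewrite fine_ge0.
have := @gap_seq_eventually_le n (fine b + e / 2) (fine b + e) n0.
rewrite ltr_wpDl// ltrD2l => /(_ isT).
rewrite ltr_pdivrMr// ltr_pMr// ltr1n => /(_ isT).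
rewrite EFinD -bE => /(_ (ltW nlt)) [N _ HN].
rewrite /limn_esup /limf_esup; apply: ge_ereal_inf.
exists (ereal_sup (gap_seq @` [set n | (N <= n)%N])).
  by exists [set n | (N <= n)%N] => //; exists N.
apply: ge_ereal_sup => _ [k Nk <-].
by have := HN k Nk; rewrite EFinD -bE.
Qed.

End powers.

Section spectral_gap.
Context (R : realType) (d : measure_display) (Omega : measurableType d).
Variables (p : R.-pker Omega ~> Omega) (pi : probability Omega R).
Hypothesis inv : invariant_measure p pi.

(** Rests on the identity that the flow across A equals pi(A) pi(A^c) - |P^n f|^2 for f = 1_A -
    pi(A), together with |f|^2 = pi(A) pi(A^c). *)
Lemma kPP_lower n (rho : R) :
  (forall f, L20 pi f ->
    \int[pi]_x (iter n (markov_op p) f x ^+ 2) <= rho * \int[pi]_x (f x ^+ 2)) ->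
  ((1 - rho)%:E <= kPP p pi n)%E.
Proof.
move=> H; apply: le_ereal_inf_tmp => _ [A [mA A01] <-].
rewrite kPP_ratio// lee_fin; set q := kernel_pow p n; set a := fine (pi A).
have invq := invariant_kernel_pow inv n.
have [a0 a1] : 0 < a /\ a < 1.
  by apply/andP; move: A01; rewrite -[pi A]fineK ?fin_num_measure// !lte_fin.
rewrite ler_pdivlMr ?mulr_gt0 ?subr_gt0//.
have AL := Lfun2_indic pi mA.
pose u x := fine (q x A).
have uE : markov_op q \1_A = u by apply/funext => x; rewrite markov_op_indic.
have [uL _] := Lfun2_markov_op invq AL; rewrite uE in uL.
have intA : \int[pi]_x (\1_A x : R) = a.
  by rewrite /Rintegral integral_indic// setIT.
have intA2 : \int[pi]_x ((\1_A x : R) ^+ 2) = a.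
  rewrite -intA; apply: eq_Rintegral => x _.
  by rewrite indicE; case: (_ \in _); rewrite ?expr1n ?expr0n.
have intu : \int[pi]_x u x = a by rewrite -uE Rintegral_markov_op.
have gL := Lfun2D AL (Lfun2_cst pi (- a)).
have g0 : L20 pi (fun x => (\1_A x : R) + - a).
  split => //; rewrite RintegralD//; last 2 first.
  - exact: Lfun2_integrable.
  - exact: (Lfun2_integrable (Lfun2_cst _ _)).
  by rewrite Rintegral_cst1 intA subrr.
have := H _ g0; rewrite Rintegral_iter_sqr//.
have -> : \int[pi]_x (markov_op q (fun y => (\1_A y : R) + - a) x ^+ 2) =
    \int[pi]_x ((u x + - a) ^+ 2).
  apply: ae_eq_Rintegral.
  - by apply: measurable_funX; apply: measurable_markov_op; exact: Lfun2_measurable gL.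
  - by apply: measurable_funX; apply: measurable_funD => //; exact: Lfun2_measurable uL.
  by apply: filterS (markov_opDc invq (- a) AL) => x ->; rewrite uE.
rewrite !Rintegral_sqrDc// intu intA intA2 => h.
have -> : flow pi q A = a - \int[pi]_x (u x ^+ 2).
  rewrite -intu -RintegralB//; last 2 first.
  - exact: Lfun2_integrable.
  - exact: Lfun2_integrable_sqr.
  by apply: eq_Rintegral => x _; rewrite /u; ring.
by move: h; rewrite sqrrN; lra.
Qed.

Lemma spectral_gap_kPP : spectral_gap pi (markov_op p) ->
  exists n0 : nat, (0 < n0)%N /\ (0 < kPP p pi n0)%E.
Proof.
move=> [l l1 cvl].
(* The limit l may be -oo, so a real number in ]0, 1[ above it is chosen. *)
have [r /andP[r0 r1] lr] : exists2 r : R, 0 < r < 1 & (l < r%:E)%E.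
  case: l l1 {cvl} => [l|//|_].
    rewrite lte_fin => l1; exists ((Num.max l 0 + 1) / 2).
      have : 0 <= Num.max l 0 by rewrite le_max lexx orbT.
      have : Num.max l 0 < 1 by rewrite gt_max l1 ltr01.
      by move=> h1 h2; apply/andP; split; lra.
    rewrite lte_fin; have : l <= Num.max l 0 by rewrite le_max lexx.
    by lra.
  by exists (1 / 2); [apply/andP; split; lra|rewrite ltNyr].
have [N _ HN] := cvl _ (open_ereal_lt' lr).
have := HN N.+1 (leqnSn N); set n := N.+1 => /ltW nr.
exists n; split => //.
have := (gap_seq_leP inv (n := n) isT (ltW r0)).1 nr.
move/kPP_lower; apply: lt_le_trans.
by rewrite lte_fin subr_gt0 expr_lt1// ?exprn_ge0 ?expr_lt1// ltW.
Qed.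

Lemma kPP_spectral_gap n : (0 < n)%N -> (0 < kPP p pi n)%E ->
  spectral_gap pi (markov_op p).
Proof.
move=> n0 /(kPP_strict_contraction inv)[rho rho1 H].
(* rho may be nonpositive, while the rate s below must be positive. *)
pose t := Num.max rho (1 / 2).
have t0 : 0 < t by rewrite lt_max; apply/orP; right; lra.
have t1 : t < 1 by rewrite gt_max rho1 /=; lra.
pose s := Num.sqrt t `^ n%:R^-1.
have nN0 : n%:R != 0 :> R by rewrite pnatr_eq0 -lt0n.
have sn : s ^+ n = Num.sqrt t.
  by rewrite -powR_mulrn ?powR_ge0// -powRrM mulVf// powRr1// sqrtr_ge0.
have s0 : 0 < s by apply: powR_gt0; rewrite sqrtr_gt0.
have s1 : s < 1.
  rewrite -(@expr_lt1 _ n) ?ltW// sn -sqrtr1 ltr_sqrt//.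
apply: (@gap_seq_contraction_gap _ _ _ _ _ inv n s) => //; first by rewrite s0.
apply/(gap_seq_leP inv n0 (ltW s0)) => f fL; rewrite sn sqr_sqrtr; last exact: ltW.
apply: le_trans (H f fL) _; apply: ler_wpM2r.
  by apply: Rintegral_ge0 => x _; exact: sqr_ge0.
by rewrite le_max lexx.
Qed.

End spectral_gap.

(** * Resolvent *)

Section weighted_series.
Context (R : realType).
Variables (s t D h : R) (a y : nat -> R).
Hypotheses (s0 : 0 < s) (t0 : 0 < t) (ts1 : t * s < 1) (D0 : 0 <= D).
Hypothesis ha : forall j, `|a j| <= D * t ^+ j.
Hypothesis hy : forall n, \sum_(0 <= j < n) (t / s) ^+ j * y j ^+ 2 <= h.

Lemma geometric_sum_le (z : R) n : 0 <= z -> z < 1 ->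
  \sum_(0 <= j < n) z ^+ j <= (1 - z)^-1.
Proof.
move=> z0 z1; rewrite -[leRHS]mul1r ler_pdivlMr ?subr_gt0//.
have : (\sum_(0 <= j < n) z ^+ j) * (1 - z) = 1 - z ^+ n.
  elim: n => [|n IH]; first by rewrite big_geq// mul0r expr0 subrr.
  by rewrite big_nat_recr//= mulrDl IH exprS; ring.
by move=> ->; rewrite lerBlDr lerDl exprn_ge0.
Qed.

(** Weighted Cauchy-Schwarz: t^j |y_j| is the product of (t s)^(j/2) and (t / s)^(j/2) |y_j|, and
    the first factor is square-summable because t s < 1. It is proved by AM-GM in lam; the bound is
    rewritten as 8 v n to fit [sqr_le_of_amgm]. *)
Lemma weighted_series_sqr_le n :
  (\sum_(0 <= j < n) `|a j * y j|) ^+ 2 <= D ^+ 2 / (1 - t * s) * h.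
Proof.
have ts0 : 0 < t * s by rewrite mulr_gt0.
have ts1' : 0 < 1 - t * s by rewrite subr_gt0.
have h0 : 0 <= h by have := hy 0; rewrite big_geq.
rewrite (_ : D ^+ 2 / (1 - t * s) * h = 8 * (D / (2 * (1 - t * s))) * (D * h / 4)); last first.
  by field; rewrite gt_eqF.
apply: sqr_le_of_amgm.
- by apply: sumr_ge0 => j _.
- by rewrite divr_ge0// mulr_ge0// ltW.
- by rewrite divr_ge0// mulr_ge0.
move=> lam l0.
apply: (@le_trans _ _ (\sum_(0 <= j < n)
    (D / 2 * lam * (t * s) ^+ j + D / 2 / lam * ((t / s) ^+ j * y j ^+ 2)))).
  apply: ler_sum => j _; rewrite normrM.
  apply: (@le_trans _ _ (D * t ^+ j * `|y j|)); first by rewrite ler_wpM2r.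
  rewrite exprMn expr_div_n.
  have tj : 0 < t ^+ j by rewrite exprn_gt0.
  have sj : 0 < s ^+ j by rewrite exprn_gt0.
  rewrite -(real_normK (num_real (y j))).
  set u := t ^+ j in tj *; set v := s ^+ j in sj *; set w := `|y j|.
  have -> : D / 2 * lam * (u * v) + D / 2 / lam * (u / v * w ^+ 2) =
    D * u * w + D / 2 * (u / (lam * v)) * (lam * v - w) ^+ 2.
    by field; rewrite !gt_eqF.
  rewrite lerDl mulr_ge0 ?sqr_ge0// mulr_ge0 ?divr_ge0 ?(ltW tj)//.
  by rewrite mulr_ge0// ltW.
rewrite big_split/= -!mulr_sumr; apply: lerD.
  rewrite (_ : lam * (D / (2 * (1 - t * s))) = D / 2 * lam * (1 - t * s)^-1); last first.
    by field; rewrite gt_eqF.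
  by rewrite ler_wpM2l ?geometric_sum_le ?(ltW ts0)// mulr_ge0 ?divr_ge0 ?(ltW l0).
rewrite (_ : 2 / lam * (D * h / 4) = D / 2 / lam * h); last by field; rewrite gt_eqF.
by rewrite ler_wpM2l// !divr_ge0// ltW.
Qed.

Lemma weighted_series_cvg : cvgn (series (fun j => a j * y j)).
Proof.
apply: normed_cvg; apply: nondecreasing_is_cvgn.
  by apply: nondecreasing_series => j _ _; exact: normr_ge0.
(* Turns a bound on the squared partial sums into one on the sums, by u <= 1 + u^2. *)
exists (1 + D ^+ 2 / (1 - t * s) * h) => _ [n _ <-].
apply: le_trans (lerD (lexx 1) (weighted_series_sqr_le n)).
rewrite /series/=; set u := \sum_(_ <= _ < _) _.
rewrite -[leLHS]/u; have := sqr_ge0 (u - 1 / 2); rewrite expr2; nra.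
Qed.

Lemma weighted_series_partial_le n :
  series (fun j => a j * y j) n ^+ 2 <= D ^+ 2 / (1 - t * s) * h.
Proof.
apply: le_trans (weighted_series_sqr_le n).
rewrite -real_normK ?num_real// ler_pXn2r ?nnegrE ?sumr_ge0//.
exact: ler_norm_sum.
Qed.

Lemma weighted_series_lim_le :
  limn (series (fun j => a j * y j)) ^+ 2 <= D ^+ 2 / (1 - t * s) * h.
Proof.
have c := weighted_series_cvg.
have c2 : (series (fun j => a j * y j) n ^+ 2) @[n --> \oo] -->
    limn (series (fun j => a j * y j)) ^+ 2.
  by rewrite !expr2; apply: cvgM.
rewrite -(cvg_lim _ c2)//; apply: limr_le; first by apply: cvgP; exact: c2.
by apply: nearW => n; exact: weighted_series_partial_le.
Qed.

End weighted_series.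

(** * Pointwise Neumann series *)

Section neumann.
Context (R : realType) (d : measure_display) (Omega : measurableType d).
Variables (p : R.-pker Omega ~> Omega) (pi : probability Omega R).
Hypothesis inv : invariant_measure p pi.
Variables (s t C : R).
Hypotheses (s0 : 0 < s) (t0 : 0 < t) (ts1 : t * s < 1).
Local Notation P j := (iter j (markov_op p)).
Hypothesis HC : forall j f, L20 pi f ->
  \int[pi]_x (P j f x ^+ 2) <= (C * s ^+ j) ^+ 2 * \int[pi]_x (f x ^+ 2).
Implicit Types (u v : Omega -> R) (a b : nat -> R).

Let ts0 : 0 < t * s. Proof. exact: mulr_gt0. Qed.
Let tsC : 0 < 1 - t * s. Proof. by rewrite subr_gt0. Qed.

(** The weight t / s balances two demands: the j-th term integrates to at most C^2 (t s)^j |u|^2,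
    and a finite energy at x forces the convergence at x of every series with coefficients at most D
    t^j. *)
Definition energy u (x : Omega) : \bar R :=
  (\sum_(0 <= j <oo) ((t / s) ^+ j * P j u x ^+ 2)%:E)%E.

(* The Neumann series [\sum_j a_j P^j u], set to 0 where it need not converge. *)
Definition neumann a u (x : Omega) : R :=
  if (energy u x < +oo)%E then limn (series (fun j => a j * P j u x)) else 0.

Let term_ge0 u x j : (0 <= ((t / s) ^+ j * P j u x ^+ 2)%:E)%E.
Proof. by rewrite lee_fin mulr_ge0 ?sqr_ge0// exprn_ge0// divr_ge0// ltW. Qed.

Lemma energy_ge0 u x : (0 <= energy u x)%E.
Proof. by apply: nneseries_ge0 => j _ _; exact: term_ge0. Qed.

Lemma energy_partial u x n : (energy u x < +oo)%E ->
  \sum_(0 <= j < n) (t / s) ^+ j * P j u x ^+ 2 <= fine (energy u x).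
Proof.
move=> ufin; rewrite -lee_fin fineK ?ge0_fin_numE ?energy_ge0// -sumEFin.
by apply: nneseries_lim_ge => j _ _; exact: term_ge0.
Qed.

Lemma measurable_iter_markov_op j u : measurable_fun setT u ->
  measurable_fun setT (P j u).
Proof. by move=> mu; elim: j => //= j; exact: measurable_markov_op. Qed.

Let measurable_term u j : measurable_fun setT u ->
  measurable_fun setT (fun x => ((t / s) ^+ j * P j u x ^+ 2)%:E).
Proof.
move=> mu; apply/measurable_EFinP; apply: measurable_funM => //.
by apply: measurable_funX; exact: measurable_iter_markov_op.
Qed.

Lemma measurable_energy u : measurable_fun setT u -> measurable_fun setT (energy u).
Proof.
move=> mu; apply: ge0_emeasurable_sum => [j x _ _|j _]; first exact: term_ge0.
exact: measurable_term.
Qed.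

Lemma integral_energy u : L20 pi u ->
  (\int[pi]_x energy u x <= (C ^+ 2 / (1 - t * s) * \int[pi]_x (u x ^+ 2))%:E)%E.
Proof.
move=> uL; have mu := Lfun2_measurable (proj1 uL).
set N := \int[pi]_x (u x ^+ 2).
have N0 : 0 <= N by apply: Rintegral_ge0 => x _; exact: sqr_ge0.
rewrite /energy integral_nneseries//; last by move=> j; exact: measurable_term.
apply: lime_le.
  by apply: is_cvg_nneseries => j _ _; apply: integral_ge0 => x _; exact: term_ge0.
apply: nearW => n.
have E j : (\int[pi]_x ((t / s) ^+ j * P j u x ^+ 2)%:E <=
    (C ^+ 2 * N * (t * s) ^+ j)%:E)%E.
  have tsj : 0 <= (t / s) ^+ j by rewrite exprn_ge0// divr_ge0// ltW.
  under eq_integral do rewrite EFinM.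
  rewrite ge0_integralZl//; last 2 first.
  - apply/measurable_EFinP; apply: measurable_funX; exact: measurable_iter_markov_op.
  - by move=> x _; rewrite lee_fin sqr_ge0.
  rewrite (Lfun2_integral_sqr (iter_Lfun2 inv j (proj1 uL))).
  rewrite -EFinM lee_fin; apply: le_trans (ler_wpM2l tsj (HC j uL)) _.
  rewrite -/N le_eqVlt; apply/orP; left; apply/eqP.
  by rewrite !exprMn exprVn; field; rewrite expf_neq0// gt_eqF.
apply: (@le_trans _ _ (\sum_(0 <= j < n) (C ^+ 2 * N * (t * s) ^+ j)%:E)%E).
  by apply: lee_sum => j _; exact: E.
rewrite sumEFin lee_fin -mulr_sumr [leRHS]mulrAC; apply: ler_wpM2l.
  by rewrite mulr_ge0 ?sqr_ge0.
by apply: geometric_sum_le => //; exact: ltW.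
Qed.

Lemma integral_energy_fin u : L20 pi u -> (\int[pi]_x energy u x < +oo)%E.
Proof. by move/integral_energy/le_lt_trans; apply; rewrite ltry. Qed.

Lemma integrable_energy u (m : probability Omega R) : measurable_fun setT u ->
  (\int[m]_x energy u x < +oo)%E -> m.-integrable setT (energy u).
Proof.
move=> mu ufin; apply/integrableP; split; first exact: measurable_energy.
by under eq_integral do rewrite gee0_abs ?energy_ge0//.
Qed.

Lemma ae_energy_fin u (m : probability Omega R) : measurable_fun setT u ->
  (\int[m]_x energy u x < +oo)%E -> {ae m, forall x, (energy u x < +oo)%E}.
Proof.
move=> mu /(integrable_energy mu)/(integrable_ae measurableT).
by apply: filterS => x /(_ I); rewrite ge0_fin_numE ?energy_ge0.
Qed.

Section coefficients.
Variables (D : R) (a : nat -> R).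
Hypotheses (D0 : 0 <= D) (ha : forall j, `|a j| <= D * t ^+ j).

Let c0 := D ^+ 2 / (1 - t * s).
Let c0_ge0 : 0 <= c0. Proof. by rewrite divr_ge0 ?sqr_ge0// ltW. Qed.

Lemma neumann_cvg u x : (energy u x < +oo)%E ->
  series (fun j => a j * P j u x) @ \oo --> neumann a u x.
Proof.
move=> ufin; rewrite /neumann ufin.
exact: (weighted_series_cvg s0 t0 ts1 D0 ha (fun n => energy_partial n ufin)).
Qed.

Lemma neumann_partial_le u x n : (energy u x < +oo)%E ->
  series (fun j => a j * P j u x) n ^+ 2 <= c0 * fine (energy u x).
Proof.
move=> ufin.
exact: (weighted_series_partial_le s0 t0 ts1 D0 ha (fun n => energy_partial n ufin)).
Qed.

(** Valid at every x, owing to the value 0 of [neumann] where the energy is infinite. *)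
Lemma neumann_sqr_le u x : ((neumann a u x ^+ 2)%:E <= c0%:E * energy u x)%E.
Proof.
rewrite /neumann; case: ifPn => [ufin|_]; last first.
  by rewrite expr0n mule_ge0 ?lee_fin ?energy_ge0.
rewrite -[energy u x]fineK ?ge0_fin_numE ?energy_ge0// -EFinM lee_fin.
exact: (weighted_series_lim_le s0 t0 ts1 D0 ha (fun n => energy_partial n ufin)).
Qed.

Lemma measurable_partial u n : measurable_fun setT u ->
  measurable_fun setT (fun x => series (fun j => a j * P j u x) n).
Proof.
move=> mu; rewrite /series/=; apply: measurable_sum => j.
by apply: measurable_funM => //; exact: measurable_iter_markov_op.
Qed.

Lemma measurable_neumann u : measurable_fun setT u -> measurable_fun setT (neumann a u).
Proof.
move=> mu; pose E := [set x | (energy u x < +oo)%E].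
have mE : measurable E.
  rewrite -[E]setTI; apply: emeasurable_fun_infty_o => //.
  exact: measurable_energy.
(* Cut off by the indicator of finite energy, the partial sums converge everywhere. *)
apply: (@measurable_fun_cvg _ _ _ _
  (fun n x => (\1_E x : R) * series (fun j => a j * P j u x) n)).
  by move=> n; apply: measurable_funM; [exact: measurable_indic|exact: measurable_partial].
move=> x _; have [ufin|ufin] := boolP (energy u x < +oo)%E.
  rewrite indicE mem_set//=; under eq_cvg do rewrite mul1r.
  exact: neumann_cvg.
rewrite indicE memNset//=; last exact/negP.
under eq_cvg do rewrite mul0r.
by rewrite /neumann (negbTE ufin); exact: cvg_cst.
Qed.

Lemma Lfun2_neumann u : L20 pi u -> neumann a u \in Lfun pi 2%:E /\
  \int[pi]_x (neumann a u x ^+ 2) <=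
    (D * C / (1 - t * s)) ^+ 2 * \int[pi]_x (u x ^+ 2).
Proof.
move=> uL; have mu := Lfun2_measurable (proj1 uL).
have mN := measurable_neumann mu.
have le1 : (\int[pi]_x (neumann a u x ^+ 2)%:E <=
    ((D * C / (1 - t * s)) ^+ 2 * \int[pi]_x (u x ^+ 2))%:E)%E.
  apply: (@le_trans _ _ (\int[pi]_x (c0%:E * energy u x))%E).
    apply: ge0_le_integral => //.
    - by move=> x _; rewrite lee_fin sqr_ge0.
    - exact/measurable_EFinP/measurable_funX.
    - by apply: measurable_funeM; exact: measurable_energy.
    - by move=> x _; exact: neumann_sqr_le.
  rewrite ge0_integralZl//; last 2 first.
  - exact: measurable_energy.
  - by move=> x _; exact: energy_ge0.
  apply: le_trans (lee_wpmul2l _ (integral_energy uL)) _; first by rewrite lee_fin.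
  rewrite -EFinM lee_fin le_eqVlt; apply/orP; left; apply/eqP.
  by rewrite /c0; field; rewrite gt_eqF.
have NL : neumann a u \in Lfun pi 2%:E.
  by apply/Lfun2P; split => //; rewrite (le_lt_trans le1)// ltry.
by split => //; move: le1; rewrite Lfun2_integral_sqr.
Qed.

(** The partial sums are dominated by 1 + c0 * energy. Taking m = pi gives the mean of the series; m
    = p(x, .) lets P pass inside the sum. *)
Lemma neumann_dominated u (m : probability Omega R) : measurable_fun setT u ->
  (\int[m]_x energy u x < +oo)%E ->
  (fun n => \int[m]_x series (fun j => a j * P j u x) n) @ \oo -->
    \int[m]_x neumann a u x.
Proof.
move=> mu ufin; have mN := measurable_neumann mu.
have ae := ae_energy_fin mu ufin.
pose g x := (1 + c0%:E * energy u x)%E.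
have gi : m.-integrable setT g.
  apply: (integrableD measurableT (f := fun=> 1%E)).
    exact: (Lfun2_integrable (Lfun2_cst m 1)).
  by apply: (integrableZl measurableT); exact: integrable_energy.
pose S n x := series (fun j => a j * P j u x) n.
have mS n : measurable_fun setT (EFin \o S n).
  exact/measurable_EFinP/measurable_partial.
have mN' : measurable_fun setT (EFin \o neumann a u) by exact/measurable_EFinP.
have SN : {ae m, forall x, setT x ->
    (fun n => (EFin \o S n) x) @ \oo --> (EFin \o neumann a u) x}.
  apply: filterS ae => x ux _; apply: cvg_EFin; first exact: nearW.
  exact: neumann_cvg.
have Sg : {ae m, forall x n, setT x -> (`|(EFin \o S n) x| <= g x)%E}.
  apply: filterS ae => x ux n _; have h := neumann_partial_le n ux.
  rewrite /g -[energy u x]fineK ?ge0_fin_numE ?energy_ge0// -EFinM -EFinD lee_fin.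
  apply: le_trans (lerD (lexx 1) h); rewrite -/(S n x).
  rewrite -(real_normK (num_real (S n x))).
  by have := sqr_ge0 (`|S n x| - 1 / 2); rewrite expr2; nra.
have [Ni _ cv] := dominated_convergence measurableT mS mN' SN gi Sg.
rewrite /Rintegral; apply: fine_cvg.
rewrite fineK; last exact: integrable_fin_num Ni.
exact: cv.
Qed.

Lemma Rintegral_neumann u : L20 pi u -> \int[pi]_x neumann a u x = 0.
Proof.
move=> uL; have mu := Lfun2_measurable (proj1 uL).
have cv := neumann_dominated mu (integral_energy_fin uL).
suff E n : \int[pi]_x series (fun j => a j * P j u x) n = 0.
  rewrite -(cvg_lim _ cv)//; apply: cvg_lim => //.
  by rewrite (eq_cvg _ _ E); exact: cvg_cst.
have [] : L20 pi (fun x => series (fun j => a j * P j u x) n) => //.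
elim: n => [|n [IHL IH0]].
  rewrite (_ : (fun _ => _) = fun=> 0); last by apply/funext => x; rewrite /series/= big_geq.
  by split; [exact: Lfun2_cst|rewrite Rintegral_cst1].
have [PL P0] := iter_L20 inv n uL; have aPL := Lfun2Z (a n) PL.
rewrite (_ : (fun _ => _) =
    fun x => series (fun j => a j * P j u x) n + a n * P n u x); last first.
  by apply/funext => x; rewrite seriesSr.
split; first exact: Lfun2D.
rewrite RintegralD//; [|exact: Lfun2_integrable|exact: Lfun2_integrable].
by rewrite IH0 add0r RintegralZl ?P0 ?mulr0//; exact: Lfun2_integrable.
Qed.

Lemma L20_neumann u : L20 pi u -> L20 pi (neumann a u).
Proof.
by move=> uL; split; [exact: (Lfun2_neumann uL).1|exact: Rintegral_neumann].
Qed.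

Lemma markov_op_neumann_cvg u : L20 pi u -> {ae pi, forall x,
  series (fun j => a j * P j.+1 u x) @ \oo --> markov_op p (neumann a u) x}.
Proof.
move=> uL; have mu := Lfun2_measurable (proj1 uL).
have PL : {ae pi, forall x, forall j, P j u \in Lfun (kernel_prob p x) 2%:E}.
  by apply/ae_foralln => j; apply: (Lfun2_kernel inv); exact: (iter_Lfun2 inv j (proj1 uL)).
have ufin := integral_mixture_fin inv (energy_ge0 u) (measurable_energy mu)
  (integral_energy_fin uL).
apply: filterS2 PL ufin => x PL /=; rewrite kernel_probE => ufin.
have := neumann_dominated mu ufin; rewrite -markov_opE.
suff E n : \int[kernel_prob p x]_y series (fun j => a j * P j u y) n =
    series (fun j => a j * P j.+1 u x) n.
  by rewrite (eq_cvg _ _ E).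
suff [] : (fun y => series (fun j => a j * P j u y) n) \in Lfun (kernel_prob p x) 2%:E /\
    \int[kernel_prob p x]_y series (fun j => a j * P j u y) n =
    series (fun j => a j * P j.+1 u x) n by [].
elim: n => [|n [IHL IH]].
  rewrite (_ : (fun _ => _) = fun=> 0); last by apply/funext => y; rewrite /series/= big_geq.
  by split; [exact: Lfun2_cst|rewrite Rintegral_cst1 /series/= big_geq].
have aPL := Lfun2Z (a n) (PL n).
rewrite (_ : (fun _ => _) =
    fun y => series (fun j => a j * P j u y) n + a n * P n u y); last first.
  by apply/funext => y; rewrite seriesSr.
split; first exact: Lfun2D.
rewrite RintegralD//; [|exact: Lfun2_integrable|exact: Lfun2_integrable].
rewrite IH RintegralZl//; last exact: Lfun2_integrable.
by rewrite seriesSr -markov_opE.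
Qed.

(** Applying P shifts the index by one, and the term c u fills the vacant position 0. *)
Lemma markov_op_neumann_shift (c : R) (al : nat -> R) u : L20 pi u ->
  al 0%N = c -> (forall j, al j.+1 = a j) ->
  {ae pi, forall x, series (fun j => al j * P j u x) @ \oo -->
                    c * u x + markov_op p (neumann a u) x}.
Proof.
move=> uL al0 al1; apply: filterS (markov_op_neumann_cvg uL) => x cv.
rewrite -(cvg_shiftn 1)/=.
have E n : series (fun j => al j * P j u x) (n + 1)%N =
    c * u x + series (fun j => a j * P j.+1 u x) n.
  rewrite addn1; elim: n => [|n IH].
    by rewrite seriesSr /series/= !big_geq// al0 add0r addr0.
  by rewrite seriesSr IH [in RHS]seriesSr al1 addrA.
by rewrite (eq_cvg _ _ E); apply: cvgD => //; exact: cvg_cst.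
Qed.

End coefficients.
End neumann.

Section neumann_resolvent.
Context (R : realType) (d : measure_display) (Omega : measurableType d).
Variables (p : R.-pker Omega ~> Omega) (pi : probability Omega R).
Hypothesis inv : invariant_measure p pi.
Variables (s t C D : R).
Hypotheses (s0 : 0 < s) (t0 : 0 < t) (ts1 : t * s < 1) (D0 : 0 <= D).
Local Notation P j := (iter j (markov_op p)).
Hypothesis HC : forall j f, L20 pi f ->
  \int[pi]_x (P j f x ^+ 2) <= (C * s ^+ j) ^+ 2 * \int[pi]_x (f x ^+ 2).
Implicit Types (u v : Omega -> R) (a b : nat -> R).
Local Notation N a := (neumann p s t a).

Let ae_energy u : L20 pi u -> {ae pi, forall x, (energy p s t u x < +oo)%E}.
Proof.
move=> uL; apply: (ae_energy_fin s0 t0 (Lfun2_measurable (proj1 uL))).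
exact: (integral_energy_fin inv s0 t0 ts1 HC uL).
Qed.

Lemma L20_linear (c1 c2 : R) u v : L20 pi u -> L20 pi v ->
  L20 pi (fun x => c1 * u x + c2 * v x).
Proof.
move=> [uL u0] [vL v0]; have cuL := Lfun2Z c1 uL; have cvL := Lfun2Z c2 vL.
split; first exact: Lfun2D.
rewrite RintegralD//; [|exact: Lfun2_integrable|exact: Lfun2_integrable].
by rewrite !RintegralZl ?u0 ?v0 ?mulr0 ?addr0//; exact: Lfun2_integrable.
Qed.

(** The real and imaginary parts of (z - P)(u + i v) have this shape, with c1 = Re z, c2 = -Im z or
    Im z, and w = u or v. *)
Lemma L20_resolvent_arg (c1 c2 : R) u v w : L20 pi u -> L20 pi v -> L20 pi w ->
  L20 pi (fun x => c1 * u x + c2 * v x - markov_op p w x).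
Proof.
move=> uL vL wL.
have := L20_linear 1 (-1) (L20_linear c1 c2 uL vL) (L20_markov_op inv wL).
by under eq_fun do rewrite mul1r mulN1r.
Qed.

(** Each application of P costs a null set; their countable union gives one exceptional set for all
    j, as the comparison of series at a point demands. *)
Lemma iter_resolvent_arg (c1 c2 : R) u v w : L20 pi u -> L20 pi v -> L20 pi w ->
  {ae pi, forall x j, P j (fun y => c1 * u y + c2 * v y - markov_op p w y) x =
                      c1 * P j u x + c2 * P j v x - P j.+1 w x}.
Proof.
move=> uL vL wL; pose g y := c1 * u y + c2 * v y - markov_op p w y; rewrite -/g.
have gL : L20 pi g := L20_resolvent_arg c1 c2 uL vL wL.
have PL j h : L20 pi h -> P j h \in Lfun pi 2%:E.
  by move=> hL; exact: (proj1 (iter_L20 inv j hL)).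
apply/ae_foralln; elim=> [|j IH]; first exact: aeW.
have cL := Lfun2D (Lfun2Z c1 (PL j _ uL)) (Lfun2Z c2 (PL j _ vL)).
have H1 : {ae pi, forall x, markov_op p (P j g) x =
    markov_op p (fun y => 1 * (c1 * P j u y + c2 * P j v y) + -1 * P j.+1 w y) x}.
  apply: (markov_op_ae_eq inv).
  - exact: Lfun2_measurable (PL j _ gL).
  - exact: Lfun2_measurable (Lfun2D (Lfun2Z 1 cL) (Lfun2Z (-1) (PL j.+1 _ wL))).
  by apply: filterS IH => x ->; rewrite mul1r mulN1r.
have H2 := markov_op_linear inv 1 (-1) cL (PL j.+1 _ wL).
have H3 := markov_op_linear inv c1 c2 (PL j _ uL) (PL j _ vL).
apply: filterS3 H1 H2 H3 => x /= -> -> ->.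
by rewrite mul1r mulN1r.
Qed.

(** The partial sums of both sides agree, so the limits do. This moves z - P out of the series,
    which reduces the left inverse to [neumann_shift]. *)
Lemma neumann_resolvent_arg a (c1 c2 : R) u v w :
  (forall j, `|a j| <= D * t ^+ j) -> L20 pi u -> L20 pi v -> L20 pi w ->
  {ae pi, forall x, N a (fun y => c1 * u y + c2 * v y - markov_op p w y) x =
    c1 * N a u x + c2 * N a v x - markov_op p (N a w) x}.
Proof.
move=> ha uL vL wL; pose g y := c1 * u y + c2 * v y - markov_op p w y; rewrite -/g.
have gL : L20 pi g := L20_resolvent_arg c1 c2 uL vL wL.
have H := iter_resolvent_arg c1 c2 uL vL wL; rewrite -/g in H.
have Hw := markov_op_neumann_cvg inv s0 t0 ts1 HC D0 ha wL.
have Hg : {ae pi, forall x, series (fun j => a j * P j g x) @ \oo --> N a g x}.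
  by apply: filterS (ae_energy gL) => x; exact: (neumann_cvg s0 t0 ts1 D0 ha).
have Huv : {ae pi, forall x, series (fun j => a j * P j u x) @ \oo --> N a u x /\
                             series (fun j => a j * P j v x) @ \oo --> N a v x}.
  by apply: filterS2 (ae_energy uL) (ae_energy vL) => x ux vx; split; exact: (neumann_cvg s0 t0 ts1 D0 ha).
have HH : {ae pi, forall x, (series (fun j => a j * P j g x) @ \oo --> N a g x) /\
    (forall j, P j g x = c1 * P j u x + c2 * P j v x - P j.+1 w x)}.
  by apply: filterS2 Hg H.
apply: filterS3 HH Huv Hw => x [cg E] [cu cv] cw.
have cR : (fun n => c1 * series (fun j => a j * P j u x) n +
    c2 * series (fun j => a j * P j v x) n - series (fun j => a j * P j.+1 w x) n)
    @ \oo --> c1 * N a u x + c2 * N a v x - markov_op p (N a w) x.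
  apply: cvgB => //; apply: cvgD; apply: cvgM => //; exact: cvg_cst.
have En n : series (fun j => a j * P j g x) n =
    c1 * series (fun j => a j * P j u x) n +
    c2 * series (fun j => a j * P j v x) n - series (fun j => a j * P j.+1 w x) n.
  elim: n => [|n IH]; first by rewrite /series/= !big_geq// !mulr0 addr0 subr0.
  by rewrite !seriesSr IH E; ring.
rewrite -(cvg_lim _ cg)//; apply: cvg_lim => //.
by rewrite (eq_cvg _ _ En).
Qed.

(* The identity z S = 1 + P S for S = \sum_j z^-(j+1) P^j, split into real and
   imaginary parts. *)
Lemma neumann_shift a b a' (c1 c2 h : R) u :
  (forall j, `|a j| <= D * t ^+ j) -> (forall j, `|b j| <= D * t ^+ j) ->
  (forall j, `|a' j| <= D * t ^+ j) -> L20 pi u ->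
  c1 * a 0%N + c2 * b 0%N = h ->
  (forall j, c1 * a j.+1 + c2 * b j.+1 = a' j) ->
  {ae pi, forall x, c1 * N a u x + c2 * N b u x = h * u x + markov_op p (N a' u) x}.
Proof.
move=> ha hb ha' uL h0 h1.
have H := markov_op_neumann_shift (al := fun j => c1 * a j + c2 * b j)
  inv s0 t0 ts1 HC D0 ha' uL h0 h1.
apply: filterS2 H (ae_energy uL) => x cs ux.
rewrite -(cvg_lim _ cs)//; apply/esym; apply: cvg_lim => //.
have E n : series (fun j => (c1 * a j + c2 * b j) * P j u x) n =
    c1 * series (fun j => a j * P j u x) n + c2 * series (fun j => b j * P j u x) n.
  elim: n => [|n IH]; first by rewrite /series/= !big_geq// !mulr0 addr0.
  by rewrite !seriesSr IH; ring.
rewrite (eq_cvg _ _ E); apply: cvgD; apply: cvgM;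
  by [exact: cvg_cst|exact: (neumann_cvg s0 t0 ts1 D0 ha)|exact: (neumann_cvg s0 t0 ts1 D0 hb)].
Qed.

End neumann_resolvent.

(** * The complex resolvent from its real and imaginary parts *)

Section complex_parts.
Context (R : realType).
Implicit Types x y : R[i].

Lemma ReM x y : complex.Re (x * y) =
  complex.Re x * complex.Re y - complex.Im x * complex.Im y.
Proof. by case: x y => [? ?] [? ?]. Qed.

Lemma ImM x y : complex.Im (x * y) =
  complex.Re x * complex.Im y + complex.Im x * complex.Re y.
Proof. by case: x y => [? ?] [? ?]. Qed.

Lemma abs_Re_le x : `|complex.Re x| <= Normc.normc x.
Proof. by case: x => [? ?] /=; rewrite -sqrtr_sqr ler_wsqrtr// lerDl sqr_ge0. Qed.

Lemma abs_Im_le x : `|complex.Im x| <= Normc.normc x.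
Proof. by case: x => [? ?] /=; rewrite -sqrtr_sqr ler_wsqrtr// lerDr sqr_ge0. Qed.

Lemma complex_ext x y : complex.Re x = complex.Re y -> complex.Im x = complex.Im y ->
  x = y.
Proof. by case: x y => [? ?] [? ?] /= -> ->. Qed.

Lemma normcX x n : Normc.normc (x ^+ n) = Normc.normc x ^+ n.
Proof.
by elim: n => [|n IH]; rewrite ?expr0 ?Normc.normc1// !exprS Normc.normcM IH.
Qed.

End complex_parts.

Section complex_resolvent.
Context (R : realType) (d : measure_display) (Omega : measurableType d).
Variables (p : R.-pker Omega ~> Omega) (pi : probability Omega R).
Hypothesis inv : invariant_measure p pi.

Lemma cL20P (f : Omega -> R[i]) : cL20 pi f <->
  L20 pi (fun x => complex.Re (f x)) /\ L20 pi (fun x => complex.Im (f x)).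
Proof.
split; last by move=> [[r0 r1] [i0 i1]]; split => //; rewrite /cintegral r1 i1.
by case=> rL iL; rewrite /cintegral => -[r0 i0]; split; split.
Qed.

Lemma cL2normE (f : Omega -> R[i]) :
  (fun x => complex.Re (f x)) \in Lfun pi 2%:E ->
  (fun x => complex.Im (f x)) \in Lfun pi 2%:E ->
  cL2norm pi f = ((\int[pi]_x (complex.Re (f x) ^+ 2) +
                   \int[pi]_x (complex.Im (f x) ^+ 2)) `^ 2^-1)%:E.
Proof.
move=> rL iL; rewrite -poweR_EFin.
transitivity ('N[pi]_2%:E[EFin \o (fun x => complex.Re `|f x|)%R])%E; first by [].
rewrite Lnorm2E.
congr (_ `^ _)%E; rewrite EFinD -!Lfun2_integral_sqr//.
have mr := Lfun2_measurable rL; have mi := Lfun2_measurable iL.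
rewrite -ge0_integralD//; last 4 first.
- by move=> x _; rewrite lee_fin sqr_ge0.
- exact/measurable_EFinP/measurable_funX.
- by move=> x _; rewrite lee_fin sqr_ge0.
- exact/measurable_EFinP/measurable_funX.
apply: eq_integral => x _; rewrite -EFinD; congr EFin.
by rewrite normc_def/= sqr_sqrtr// addr_ge0 ?sqr_ge0.
Qed.

Lemma Rintegral_sqrD_le (c1 c2 : R) (f g : Omega -> R) :
  f \in Lfun pi 2%:E -> g \in Lfun pi 2%:E ->
  \int[pi]_x ((c1 * f x + c2 * g x) ^+ 2) <=
  2 * c1 ^+ 2 * \int[pi]_x (f x ^+ 2) + 2 * c2 ^+ 2 * \int[pi]_x (g x ^+ 2).
Proof.
move=> fL gL; have cfL := Lfun2Z c1 fL; have cgL := Lfun2Z c2 gL.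
have i1 c h : h \in Lfun pi 2%:E ->
    pi.-integrable setT (EFin \o (fun x => c * h x ^+ 2)).
  move=> /Lfun2_integrable_sqr hi; have := integrableZl measurableT c hi.
  by apply: eq_integrable.
rewrite -RintegralZl//; last exact: Lfun2_integrable_sqr.
rewrite -RintegralZl//; last exact: Lfun2_integrable_sqr.
rewrite -RintegralD//; [|exact: i1|exact: i1].
apply: le_Rintegral => //.
- exact: (Lfun2_integrable_sqr (Lfun2D cfL cgL)).
- have := integrableD measurableT (i1 (2 * c1 ^+ 2) _ fL) (i1 (2 * c2 ^+ 2) _ gL).
  by apply: eq_integrable.
move=> x _; rewrite -subr_ge0.
rewrite (_ : _ - _ = (c1 * f x - c2 * g x) ^+ 2) ?sqr_ge0//; ring.
Qed.

(** The inverse is the sum of z^-(j+1) P^j. Its coefficients have modulus t * t^j with t = 1/|z|, so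
    D = t, and s < |z| is the condition t s < 1. Since P preserves real functions, two real Neumann
    series suffice. *)
Lemma resolvent_set_power_bound (s C : R) (z : R[i]) : 0 < s ->
  s < Normc.normc z ->
  (forall j f, L20 pi f -> \int[pi]_x (iter j (markov_op p) f x ^+ 2) <=
                           (C * s ^+ j) ^+ 2 * \int[pi]_x (f x ^+ 2)) ->
  resolvent_set pi (cmarkov_op p) z.
Proof.
move=> s0 sz HC; set zeta := Normc.normc z in sz.
have zeta0 : 0 < zeta := lt_trans s0 sz.
have z0 : z != 0 by apply/eqP => zE; move: zeta0; rewrite /zeta zE Normc.normc0 ltxx.
pose t := zeta^-1.
have t0 : 0 < t by rewrite invr_gt0.
have ts1 : t * s < 1 by rewrite mulrC ltr_pdivrMr// mul1r.
pose c j : R[i] := (z^-1) ^+ j.+1.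
pose a j := complex.Re (c j); pose b j := complex.Im (c j).
have zc0 : z * c 0%N = 1 by rewrite /c expr1 divff.
have zcS j : z * c j.+1 = c j by rewrite /c exprS mulrA divff// mul1r.
have nc j : Normc.normc (c j) = t * t ^+ j.
  by rewrite /c normcX Normc.normcV exprS.
have ha j : `|a j| <= t * t ^+ j by rewrite -nc; exact: abs_Re_le.
have hb j : `|b j| <= t * t ^+ j by rewrite -nc; exact: abs_Im_le.
set zr := complex.Re z; set zi := complex.Im z.
have E0r : zr * a 0%N + (- zi) * b 0%N = 1.
  by have := congr1 (@complex.Re R) zc0; rewrite ReM mulNr.
have E0i : zr * b 0%N + zi * a 0%N = 0.
  by have := congr1 (@complex.Im R) zc0; rewrite ImM.
have ESr j : zr * a j.+1 + (- zi) * b j.+1 = a j.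
  by have := congr1 (@complex.Re R) (zcS j); rewrite ReM mulNr.
have ESi j : zr * b j.+1 + zi * a j.+1 = b j.
  by have := congr1 (@complex.Im R) (zcS j); rewrite ImM.
pose N a := neumann p s t a.
have shift_r u : L20 pi u -> {ae pi, forall x,
    zr * N a u x + (- zi) * N b u x = 1 * u x + markov_op p (N a u) x}.
  by move=> uL; exact: (neumann_shift inv s0 t0 ts1 (ltW t0) HC ha hb ha uL E0r ESr).
have shift_i u : L20 pi u -> {ae pi, forall x,
    zr * N b u x + zi * N a u x = 0 * u x + markov_op p (N b u) x}.
  by move=> uL; exact: (neumann_shift inv s0 t0 ts1 (ltW t0) HC hb ha hb uL E0i ESi).
have NaL u : L20 pi u -> L20 pi (N a u).
  exact: (L20_neumann inv s0 t0 ts1 HC (ltW t0) ha).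
have NbL u : L20 pi u -> L20 pi (N b u).
  exact: (L20_neumann inv s0 t0 ts1 HC (ltW t0) hb).
(* The two parts of (N a + i N b)(u + i v); the coefficients 1 and -1 are kept to match the
   linearity lemmas. *)
pose Tr u v x := 1 * N a u x + (-1) * N b v x.
pose Ti u v x := 1 * N b u x + 1 * N a v x.
have TrL u v : L20 pi u -> L20 pi v -> L20 pi (Tr u v).
  by move=> uL vL; apply: L20_linear; [exact: NaL|exact: NbL].
have TiL u v : L20 pi u -> L20 pi v -> L20 pi (Ti u v).
  by move=> uL vL; apply: L20_linear; [exact: NbL|exact: NaL].
pose T (F : Omega -> R[i]) x : R[i] :=
  Complex (Tr (fun y => complex.Re (F y)) (fun y => complex.Im (F y)) x)
          (Ti (fun y => complex.Re (F y)) (fun y => complex.Im (F y)) x).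
(* The inverse identities at a point, with the values of the four series and of their images under P
   replaced by free reals. *)
have alg_l_re (x1 x2 x3 x4 pa pb u v : R) :
    zr * x1 + (- zi) * x2 = 1 * u + pa -> zr * x3 + zi * x4 = 0 * v + pb ->
    1 * (zr * x1 + (- zi) * x4 - pa) + (-1) * (zr * x3 + zi * x2 - pb) = u.
  by clear; lra.
have alg_l_im (x1 x2 x3 x4 pa pb u v : R) :
    zr * x1 + (- zi) * x2 = 1 * v + pa -> zr * x3 + zi * x4 = 0 * u + pb ->
    1 * (zr * x3 + (- zi) * x2 - pb) + 1 * (zr * x1 + zi * x4 - pa) = v.
  by clear; lra.
have alg_r_re (x1 x2 x3 x4 pa pb u v : R) :
    zr * x1 + (- zi) * x2 = 1 * u + pa -> zr * x3 + zi * x4 = 0 * v + pb ->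
    zr * (1 * x1 + (-1) * x3) - zi * (1 * x2 + 1 * x4) -
    (1 * pa + (-1) * pb) = u.
  by clear; lra.
have alg_r_im (x1 x2 x3 x4 pa pb u v : R) :
    zr * x1 + (- zi) * x2 = 1 * v + pa -> zr * x3 + zi * x4 = 0 * u + pb ->
    zr * (1 * x3 + 1 * x1) + zi * (1 * x4 + (-1) * x2) -
    (1 * pb + 1 * pa) = v.
  by clear; lra.
exists T; split.
- by move=> f /cL20P[rL iL]; apply/cL20P; split; [exact: TrL|exact: TiL].
(* K^2 carries a factor 4: each part of T f is a sum of two terms, so its square costs a factor 2,
   and |u|^2 and |v|^2 each occur in both parts. *)
- pose K := 2 * `|t * C / (1 - t * s)|.
  exists K => f /cL20P[]; set u := fun x => complex.Re (f x).
  set v := fun x => complex.Im (f x) => uL vL.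
  rewrite !cL2normE ?(proj1 uL) ?(proj1 vL) ?(proj1 (TrL _ _ uL vL)) ?(proj1 (TiL _ _ uL vL))//.
  rewrite -EFinM lee_fin -/u -/v.
  set U := \int[pi]_x (u x ^+ 2); set V := \int[pi]_x (v x ^+ 2).
  have U0 : 0 <= U by apply: Rintegral_ge0 => x _; exact: sqr_ge0.
  have V0 : 0 <= V by apply: Rintegral_ge0 => x _; exact: sqr_ge0.
  have K0 : 0 <= K by rewrite mulr_ge0.
  have [aL aU] := Lfun2_neumann inv s0 t0 ts1 HC (ltW t0) ha uL.
  have [_ aV] := Lfun2_neumann inv s0 t0 ts1 HC (ltW t0) ha vL.
  have [_ bU] := Lfun2_neumann inv s0 t0 ts1 HC (ltW t0) hb uL.
  have [_ bV] := Lfun2_neumann inv s0 t0 ts1 HC (ltW t0) hb vL.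
  have r2 := Rintegral_sqrD_le 1 (-1) (proj1 (NaL _ uL)) (proj1 (NbL _ vL)).
  have i2 := Rintegral_sqrD_le 1 1 (proj1 (NbL _ uL)) (proj1 (NaL _ vL)).
  have K2 : K ^+ 2 = 4 * (t * C / (1 - t * s)) ^+ 2.
    by rewrite exprMn real_normK ?num_real//; ring.
  rewrite -(ger0_norm K0) -sqrtr_sqr -powR12_sqrt ?sqr_ge0// -powRM ?sqr_ge0 ?addr_ge0//.
  have UV0 : 0 <= U + V by rewrite addr_ge0.
  apply: ge0_ler_powR; [by rewrite invr_ge0| |by rewrite nnegrE mulr_ge0 ?sqr_ge0|].
    by rewrite nnegrE addr_ge0//; apply: Rintegral_ge0 => x _; exact: sqr_ge0.
  rewrite K2; move: r2 i2; rewrite -/(N a) -/(N b) -/U -/V sqrrN expr1n mulr1 => r2 i2.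
  apply: le_trans (lerD r2 i2) _.
  have alg (k au av bu bv : R) : au <= k * U -> av <= k * V -> bu <= k * U ->
      bv <= k * V -> 2 * au + 2 * bv + (2 * bu + 2 * av) <= 4 * k * (U + V).
    by move: U V {U0 V0 UV0 r2 i2 aU aV bU bV} => U V; lra.
  exact: alg aU aV bU bV.
- move=> f /cL20P[]; set u := fun x => complex.Re (f x); set v := fun x => complex.Im (f x).
  move=> uL vL.
  have gr : (fun y => complex.Re (z * f y - cmarkov_op p f y)) =
      (fun y => zr * u y + (- zi) * v y - markov_op p u y).
    by apply/funext => y; rewrite raddfB/= ReM mulNr.
  have gi : (fun y => complex.Im (z * f y - cmarkov_op p f y)) =
      (fun y => zr * v y + zi * u y - markov_op p v y).
    by apply/funext => y; rewrite raddfB/= ImM.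
  have ar := neumann_resolvent_arg inv s0 t0 ts1 (ltW t0) HC zr (- zi) ha uL vL uL.
  have ai := neumann_resolvent_arg inv s0 t0 ts1 (ltW t0) HC zr zi ha vL uL vL.
  have br := neumann_resolvent_arg inv s0 t0 ts1 (ltW t0) HC zr (- zi) hb uL vL uL.
  have bi := neumann_resolvent_arg inv s0 t0 ts1 (ltW t0) HC zr zi hb vL uL vL.
  apply: filterS2 (filterI (filterI ar ai) (filterI br bi))
    (filterI (filterI (shift_r _ uL) (shift_r _ vL))
             (filterI (shift_i _ uL) (shift_i _ vL))) => x.
  move=> [[ar' ai'] [br' bi']] [[ru rv] [iu iv]].
  rewrite /T; apply: complex_ext; rewrite /= gr gi /Tr /Ti.
    rewrite /N ar' bi'; exact: alg_l_re ru iv.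
  rewrite /N br' ai'; exact: alg_l_im rv iu.
- move=> f /cL20P[]; set u := fun x => complex.Re (f x); set v := fun x => complex.Im (f x).
  move=> uL vL.
  have lr := markov_op_linear inv 1 (-1) (proj1 (NaL _ uL)) (proj1 (NbL _ vL)).
  have li := markov_op_linear inv 1 1 (proj1 (NbL _ uL)) (proj1 (NaL _ vL)).
  apply: filterS2 (filterI lr li)
    (filterI (filterI (shift_r _ uL) (shift_r _ vL))
             (filterI (shift_i _ uL) (shift_i _ vL))) => x.
  move=> [lr' li'] [[ru rv] [iu iv]].
  apply: complex_ext; rewrite raddfB/= ?ReM ?ImM /= -/zr -/zi.
    rewrite -/(markov_op p (Tr u v) x) lr' /Tr /Ti.
    exact: alg_r_re ru iv.
  rewrite -/(markov_op p (Ti u v) x) li' /Tr /Ti.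
  exact: alg_r_im rv iu.
Qed.

End complex_resolvent.

Section spectral_radius.
Context (R : realType) (d : measure_display) (Omega : measurableType d).
Variables (p : R.-pker Omega ~> Omega) (pi : probability Omega R).
Hypothesis inv : invariant_measure p pi.

Lemma spectrum_le (n : nat) (rho : R) : (0 < n)%N ->
  (forall f, L20 pi f ->
    \int[pi]_x (iter n (markov_op p) f x ^+ 2) <= rho * \int[pi]_x (f x ^+ 2)) ->
  spectrum pi (cmarkov_op p) `<=`
    [set z : R[i] | `|z| <= real_complex R (Num.sqrt rho `^ n%:R^-1)].
Proof.
move=> n0 H z zS /=; set r := _ `^ _.
have r0 : 0 <= r := powR_ge0 _ _.
have nN0 : n%:R != 0 :> R by rewrite pnatr_eq0 -lt0n.
have rn : r ^+ n = Num.sqrt rho.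
  by rewrite -powR_mulrn// -powRrM mulVf// powRr1// sqrtr_ge0.
change (`|z|) with (real_complex R (Normc.normc z)).
rewrite lecR leNgt; apply/negP => rz; apply: zS.
(* The midpoint is below |z| and positive even when r = 0; the power bound at rate s then makes the
   Neumann series converge. *)
pose s := (r + Normc.normc z) / 2.
have s0 : 0 < s by rewrite divr_gt0// ltr_wpDl// (le_lt_trans r0).
have rs : r <= s by rewrite /s; lra.
have sz : s < Normc.normc z by rewrite /s; lra.
have Hs f : L20 pi f -> \int[pi]_x (iter n (markov_op p) f x ^+ 2) <=
    (s ^+ n) ^+ 2 * \int[pi]_x (f x ^+ 2).
  move=> fL; apply: le_trans (H f fL) _; apply: ler_wpM2r.
    by apply: Rintegral_ge0 => x _; exact: sqr_ge0.
  (* For negative rho the square root is 0 by convention, and the bound holds by sign. *)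
  have [rho0|rho0] := lerP 0 rho; last by rewrite (le_trans (ltW rho0))// sqr_ge0.
  rewrite -[leLHS]sqr_sqrtr// -rn ler_pXn2r ?nnegrE ?exprn_ge0 ?(ltW s0)//.
  by rewrite ler_pXn2r ?nnegrE ?(ltW s0).
have [C _ HC] := iter_power_bound inv n0 s0 Hs.
exact: (resolvent_set_power_bound inv s0 sz HC).
Qed.

End spectral_radius.

Unset Implicit Arguments.

Theorem proposition1 (R : realType) (d : measure_display)
    (Omega : measurableType d) (p : R.-pker Omega ~> Omega)
    (pi : probability Omega R)
    (p_rec : positive_recurrent p) (pi_inv : unique_invariant_measure p pi) :
  (spectral_gap pi (markov_op p) <->
    exists n0 : nat, (0 < n0)%N /\ (0 < kPP p pi n0)%E) /\
  (forall n0 : nat, (0 < n0)%N -> (0 < kPP p pi n0)%E ->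
    spectrum pi (cmarkov_op p) `<=`
      [set z : R[i] | `|z| <= real_complex R
        (Num.sqrt (1 - lawler_sokal R / 8 * fine (kPP p pi n0) ^+ 2)
           `^ (n0%:R^-1))]).
Proof.
have [inv _] := pi_inv; split; first split.
- exact: spectral_gap_kPP.
- by move=> [n0 [n0_gt0 k_gt0]]; exact: kPP_spectral_gap n0_gt0 k_gt0.
move=> n0 n0_gt0 k_gt0; apply: (spectrum_le inv n0_gt0) => f.
exact: kPP_contraction.
Qed.
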